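(* There is a deterministic online algorithm for the online firefighting game on cactus graphs that is $(15\sqrt{n}+1)$-competitive, where $n$ is the number of vertices of the input graph. This is asymptotically optimal: no deterministic online algorithm is $o(\sqrt{n})$-competitive on cactus graphs.
   Context: Online firefighting game: an instance is $\mathcal{I} = (G, r, (f_i)_{i\ge 1})$, where $G$ is a finite undirected graph with $n$ vertices, $r \in V(G)$ is the fire source, and $f_i \ge 0$ are integers. The graph $G$ and $r$ are known to the algorithm in advance; $f_i$ is revealed only at the beginning of round $i$. Initially only $r$ is burning. In round $i$, after learning $f_i$, the algorithm assigns at most $f_i$ firefighters to vertices that are neither burning nor already protected (a protected vertex never burns); then the fire spreads from every burning vertex to all of its unprotected neighbours. A vertex is saved if it never burns. $\mathrm{ALG}(\mathcal{I})$ is the number of vertices saved by algorithm ALG, and $\mathrm{OPT}(\mathcal{I})$ the maximum number of vertices that can be saved by any strategy knowing the whole sequence $(f_i)$ in advance. A deterministic online algorithm makes its round-$i$ decisions as a deterministic function of $G, r, f_1,\dots,f_i$. An algorithm is $c$-competitive (where $c$ may depend on $n$) on a graph class if $\mathrm{OPT}(\mathcal{I})/\mathrm{ALG}(\mathcal{I}) \le c$ for every instance whose graph is in the class and has $n$ vertices. A cactus graph is a graph in which every edge lies on at most one simple cycle (equivalently, any two simple cycles share at most one vertex). *)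

(* Defs.v *)
From HB Require Import structures.
From mathcomp Require Import all_boot all_order all_algebra.
From mathcomp Require Import boolp reals.

Set Implicit Arguments.
Unset Strict Implicit.
Unset Printing Implicit Defensive.

Import Order.TTheory GRing.Theory Num.Theory.

Record sgraph := SGraph {
  vertex :> finType;
  adj : rel vertex;
  adj_sym : symmetric adj;
  adj_irr : irreflexive adj }.

Section Cactus.
Variable G : sgraph.

Definition simple_cycle (c : seq G) : bool :=
  [&& (2 < size c)%N, uniq c & cycle (@adj G) c].

(* [next c x] is the cyclic successor of [x] in [c]. Two vertex sequences
   represent the same cycle of the graph (i.e. they differ by a rotation and
   possibly a reversal) exactly when they have the same edge set. *)
Definition cycle_edges (c : seq G) : {set {set G}} :=
  [set [set x; next c x] | x in c].

Definition cactus : Prop :=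
  forall (x y : G) (c1 c2 : seq G), adj x y ->
    simple_cycle c1 -> simple_cycle c2 ->
    [set x; y] \in cycle_edges c1 -> [set x; y] \in cycle_edges c2 ->
    cycle_edges c1 = cycle_edges c2.

End Cactus.

(* Rounds are numbered from 0: [f i] is the number of firefighters revealed in
   the (i+1)-st round and [s i] the set of vertices that receive one in that
   round; [burning r s i] and [protected s i] describe the situation after the
   first [i] rounds. *)
Section Game.
Variable G : sgraph.
Implicit Types (r : G) (f : nat -> nat) (s : nat -> {set G}).

Fixpoint protected s (i : nat) : {set G} :=
  if i is j.+1 then protected s j :|: s j else set0.

Fixpoint burning r s (i : nat) : {set G} :=
  if i is j.+1 then
    burning r s j :|:
    [set v | (v \notin protected s j.+1) && [exists u in burning r s j, adj u v]]
  else [set r].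

Definition legal r f s : Prop :=
  forall i, (#|s i| <= f i)%N /\
            [disjoint s i & burning r s i :|: protected s i].

Definition saved r s : {set G} :=
  [set v | `[< forall i, v \notin burning r s i >]].

Definition opt r f : nat :=
  \max_(k < #|G|.+1 | `[< exists s, legal r f s /\ #|saved r s| = k >]) k.

End Game.

(* A decision rule receives the graph, the fire source and the nonempty list
   of the numbers revealed so far, and returns the set of vertices to which
   firefighters are assigned in the current round. *)
Definition decision_rule := forall G : sgraph, G -> seq nat -> {set G}.

Definition play (A : decision_rule) (G : sgraph) (r : G) (f : nat -> nat) :
    nat -> {set G} :=
  fun i => A G r (mkseq f i.+1).

Definition online_algorithm (A : decision_rule) : Prop :=
  forall (G : sgraph) (r : G) (f : nat -> nat), legal r f (play A r f).

Definition alg_value (A : decision_rule) (G : sgraph) (r : G) (f : nat -> nat) :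
    nat :=
  #|saved r (play A r f)|.

(* OPT / ALG <= c in product form: the ratio is infinite when ALG = 0 < OPT,
   and an instance with ALG = OPT = 0 imposes no constraint. *)
Definition competitive (R : realType) (C : sgraph -> Prop) (A : decision_rule)
    (c : nat -> R) : Prop :=
  forall (G : sgraph) (r : G) (f : nat -> nat), C G ->
    ((opt r f)%:R <= c #|G| * (alg_value A r f)%:R)%R.

(* Main.v *)
(* Let B be the set that burns when the first firefighter arrives. Two disjoint
   connected sets of a cactus are joined by at most two edges, so a component of
   the complement of B is either entered through a single vertex, or it is an
   ear: a path with both ends attached to B, on whose vertices hang the pairwise
   disjoint sets that they dominate. If some vertex outside B dominates at least
   sqrt(n)/3 vertices, the algorithm protects it and is done. Otherwise every
   firefighter of the optimum saves few vertices by domination alone, and all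
   its other gains come from pairs of firefighters cutting off a segment of an
   ear. The algorithm spends its firefighters in pairs too: the first one opens
   the ear position of largest score among the untouched ears, the second one
   protects the last vertex of that ear which the fire coming from the other end
   has not reached. Since the k-th firefighter of the optimum never arrives
   before the k-th one of the algorithm, each ear used by the optimum can be
   charged to a pair of the algorithm that opened at least as good a position
   and closed it at least as early.

   For the lower bound, the source lies on a cycle of length about k^2 and is
   adjacent to the centre of a star with k vertices. An algorithm that does not
   use its first firefighter on the star saves at most one vertex if no other
   arrives; one that does loses the cycle if a second firefighter follows. *)

Require Import Defs.
From HB Require Import structures.
From mathcomp Require Import all_boot all_order all_algebra.
From mathcomp Require Import zify.

Set Implicit Arguments.
Unset Strict Implicit.
Unset Printing Implicit Defensive.

(** * Connectivity and cuts in cactus graphs *)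

Lemma connect_step_ind (T : finType) (e : rel T) (x : T) (P : T -> Prop) :
  P x -> (forall y z, P y -> e y z -> P z) ->
  forall y, connect e x y -> P y.
Proof.
move=> Px step y /connectP[p pp ->]; elim: p x Px pp => //= z p IH x Px.
by case/andP=> xz pp; apply: IH pp; apply: step xz.
Qed.

Section Inside.
Variable G : sgraph.
Implicit Types (x y : G) (A : {set G}).

Definition inside A x y := [&& x \in A, y \in A & adj x y].

Lemma inside_sym A : symmetric (inside A).
Proof. by move=> x y; rewrite /inside adj_sym andbCA. Qed.

Lemma connect_inside_sym A : connect_sym (inside A).
Proof. by apply: sym_connect_sym; apply: inside_sym. Qed.

Lemma connect_inside_ind A x (P : G -> Prop) :
  P x -> (forall y z, P y -> y \in A -> z \in A -> adj y z -> P z) ->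
  forall y, connect (inside A) x y -> P y.
Proof.
move=> Px step; apply: connect_step_ind => // y z Py /and3P[yA zA yz].
exact: step yz.
Qed.

Lemma connect_inside_mem A x y :
  x \in A -> connect (inside A) x y -> y \in A.
Proof. by move=> xA; move: y; apply: connect_inside_ind. Qed.

Lemma connect_insideS A A' x y :
  A \subset A' -> connect (inside A) x y -> connect (inside A') x y.
Proof.
move=> sub; move: y; apply: connect_inside_ind => // a b c aA bA ab.
apply: (connect_trans c); apply: connect1.
by rewrite /inside (subsetP sub _ aA) (subsetP sub _ bA).
Qed.

Lemma connect_inside_adj A x y :
  connect (inside A) x y -> connect (@adj G) x y.
Proof.
move: y; apply: connect_inside_ind => // a b c _ _ ab.
exact: connect_trans c (connect1 ab).
Qed.

Lemma inside_path A x p :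
  x \in A -> path (inside A) x p -> {subset x :: p <= A} /\ path (@adj G) x p.
Proof.
elim: p x => [|y p IH] x xA /=; first by split => // z; rewrite inE => /eqP->.
case/andP=> /and3P[_ yA xy] /(IH _ yA)[sub pp]; rewrite xy pp; split=> // z.
by rewrite inE => /predU1P[->|/sub].
Qed.

Definition connected_set A := forall x y, x \in A -> y \in A ->
  connect (inside A) x y.

Lemma connected_from A x :
  (forall y, y \in A -> connect (inside A) x y) -> connected_set A.
Proof.
move=> h y z yA zA; apply: connect_trans (h z zA).
by rewrite connect_inside_sym; apply: h.
Qed.

Lemma connected_component A x :
  x \in A -> connected_set [set y | connect (inside A) x y].
Proof.
move=> xA; apply: (@connected_from _ x) => y; rewrite inE => xy.
suff: connect (inside A) x y /\
    connect (inside [set y | connect (inside A) x y]) x y by case.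
move: y xy; apply: connect_inside_ind => [//|y z [xy c] yA zA yz].
have xz : connect (inside A) x z.
  by apply: (connect_trans xy); apply: connect1; rewrite /inside yA zA.
split=> //; apply: (connect_trans c); apply: connect1.
by rewrite /inside !inE xy xz.
Qed.

(** Simple paths from [a2] to [a1] in [A] and from [b1] to [b2] in [A'] close up to a cycle through
    both given edges. Its other edges stay within [A] or within [A']. *)
Lemma cross_cycle A A' a1 b1 a2 b2 :
  [disjoint A & A'] -> connected_set A -> connected_set A' ->
  a1 \in A -> a2 \in A -> b1 \in A' -> b2 \in A' ->
  adj a1 b1 -> adj a2 b2 -> (a1, b1) != (a2, b2) ->
  exists2 c, simple_cycle c & forall x y, x \in A -> y \in A' ->
    ([set x; y] \in cycle_edges c) = (((x, y) == (a1, b1)) || ((x, y) == (a2, b2))).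
Proof.
move=> dis cA cA' a1A a2A b1A b2A ab1 ab2 ne.
have /connectP[p0 pp0 lp0] := cA _ _ a2A a1A.
have /connectP[q0 qq0 lq0] := cA' _ _ b1A b2A.
move: pp0 lp0 => /shortenP[p pp up _ lp].
move: qq0 lq0 => /shortenP[q qq uq _ lq] {p0 q0}.
have [subp {}pp] := inside_path a2A pp.
have [subq {}qq] := inside_path b1A qq.
have nAA' x : x \in A -> x \in A' -> False.
  by move=> xA xA'; rewrite (disjointFr dis xA) in xA'.
pose c := a2 :: p ++ b1 :: q.
have uc : uniq c.
  rewrite /c -cat_cons cat_uniq up uq andbT.
  apply/negP=> /hasP[x xq xp].
  by apply: (nAA' x); [apply: subp | apply: subq].
exists c.
  apply/and3P; split=> //.
    (* Were both paths trivial, the two joining edges would coincide. *)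
    rewrite /= size_cat /=; case: p lp {pp up subp c uc} => [|? ?] lp;
        last by rewrite /= addnS.
    case: q lq {qq uq subq} => [|? ?] lq; last by rewrite /=; lia.
    by move: ne; rewrite /= in lp lq *; rewrite lp lq eqxx.
  rewrite (_ : cycle _ c = path (@adj G) a2 (rcons (p ++ b1 :: q) a2)) //.
  rewrite rcons_path cat_path pp /= -lp ab1 qq.
  by rewrite last_cat /= -lq adj_sym ab2.
have nextP x : x \in a2 :: p -> 
    next c x = if x == a1 then b1 else nth a2 p (index x (a2 :: p)).
  move=> xp; rewrite next_nth.
  have -> : x \in c by rewrite /c -cat_cons mem_cat xp.
  rewrite {1}/c /c -cat_cons index_cat xp nth_cat.
  have [xa|nxa] := eqVneq x a1.
    have -> : index x (a2 :: p) = size p by rewrite xa lp index_last.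
    by rewrite ltnn subnn.
  suff -> : index x (a2 :: p) < size p by [].
  have : index x (a2 :: p) < size (a2 :: p) by rewrite index_mem.
  rewrite [size (_ :: _)]/= ltnS leq_eqVlt => /predU1P[ei|//].
  by case/eqP: nxa; rewrite -(nth_index a2 xp) ei lp -nth_last /=; case: (p).
have nextQ x : x \in b1 :: q -> 
    next c x = if x == b2 then a2 else nth a2 q (index x (b1 :: q)).
  move=> xq; rewrite next_nth.
  have xp : x \notin a2 :: p.
    by apply/negP=> xp; apply: (nAA' x); [apply: subp | apply: subq].
  have -> : x \in c by rewrite /c -cat_cons mem_cat xq orbT.
  rewrite {1}/c /c -cat_cons index_cat (negbTE xp) nth_cat.
  have : x = b2 -> index x (b1 :: q) = size q by move=> ->; rewrite lq index_last.
  move: (index x (b1 :: q)) => k xb.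
  rewrite [size (a2 :: p)]/= addSn -addnS ltnNge leq_addr addKn /=.
  by have [e|//] := eqVneq x b2; rewrite (xb e) nth_default.
have inP x : x \in a2 :: p -> x != a1 -> next c x \in A.
  move=> xp nxa; rewrite (nextP x xp) (negbTE nxa).
  have : index x (a2 :: p) < size (a2 :: p) by rewrite index_mem.
  rewrite [size (_ :: _)]/= ltnS leq_eqVlt => /predU1P[ei|lt].
    by rewrite ei nth_default.
  by apply: subp; rewrite inE mem_nth ?orbT.
have inQ x : x \in b1 :: q -> x != b2 -> next c x \in A'.
  move=> xq nxb; rewrite (nextQ x xq) (negbTE nxb).
  have : index x (b1 :: q) < size (b1 :: q) by rewrite index_mem.
  rewrite [size (_ :: _)]/= ltnS leq_eqVlt => /predU1P[ei|lt].
    case/eqP: nxb; rewrite -(nth_index b1 xq) ei lq -nth_last /=; by case: (q).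
  by apply: subq; rewrite inE mem_nth ?orbT.
have a1p : a1 \in a2 :: p by rewrite lp mem_last.
have b2q : b2 \in b1 :: q by rewrite lq mem_last.
move=> x y xA yA; apply/imsetP/orP; last first.
  case=> /eqP[-> ->].
    by exists a1; rewrite ?nextP ?eqxx // /c -cat_cons mem_cat a1p.
  exists b2; rewrite ?nextQ ?eqxx 1?setUC // /c -cat_cons.
  by rewrite mem_cat b2q orbT.
case=> w; rewrite /c -cat_cons mem_cat => wc e.
have xw : x \in [set w; next c w] by rewrite -e !inE eqxx.
have yw : y \in [set w; next c w] by rewrite -e !inE eqxx orbT.
case/orP: wc => [wp|wq].
  have wA := subp _ wp.
  have yn : y = next c w.
    by move: yw; rewrite !inE => /predU1P[yw|/eqP//]; case: (nAA' w) => //; rewrite -yw.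
  have [ew|nw] := eqVneq w a1; last by case: (nAA' y) => //; rewrite yn inP.
  left; rewrite yn nextP // ew eqxx.
  move: xw; rewrite !inE => /predU1P[->|/eqP xn]; first by rewrite ew.
  by case: (nAA' x) => //; rewrite xn -yn.
have wA := subq _ wq.
have xn : x = next c w.
  by move: xw; rewrite !inE => /predU1P[xw|/eqP//]; case: (nAA' w) => //; rewrite -xw.
have [ew|nw] := eqVneq w b2; last by case: (nAA' x) => //; rewrite xn inQ.
right; rewrite xn nextQ // ew eqxx.
move: yw; rewrite !inE => /predU1P[->|/eqP yn]; first by rewrite ew.
by case: (nAA' y) => //; rewrite yn -xn.
Qed.

(* Two of three edges joining [A] to [A'] span a cycle through no third one, so
   two such cycles would share exactly one of the three edges. *)
Lemma cactus_cut A A' a1 b1 a2 b2 a3 b3 :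
  cactus G -> [disjoint A & A'] -> connected_set A -> connected_set A' ->
  a1 \in A -> a2 \in A -> a3 \in A -> b1 \in A' -> b2 \in A' -> b3 \in A' ->
  adj a1 b1 -> adj a2 b2 -> adj a3 b3 ->
  (a1, b1) != (a2, b2) -> (a3, b3) = (a1, b1) \/ (a3, b3) = (a2, b2).
Proof.
move=> cG dis cA cA' a1A a2A a3A b1A b2A b3A ab1 ab2 ab3 ne12.
have [|ne13] := eqVneq (a3, b3) (a1, b1); first by left.
rewrite eq_sym in ne13.
have [|ne23] := eqVneq (a3, b3) (a2, b2); [by right | exfalso].
have [c1 sc1 ec1] := cross_cycle dis cA cA' a1A a2A b1A b2A ab1 ab2 ne12.
have [c2 sc2 ec2] := cross_cycle dis cA cA' a1A a3A b1A b3A ab1 ab3 ne13.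
have := cG a1 b1 c1 c2 ab1 sc1 sc2; rewrite ec1 // ec2 // eqxx /=.
move=> /(_ isT isT) e; have := ec1 a3 b3 a3A b3A.
by rewrite e ec2 // eqxx orbT eq_sym (negbTE ne13) (negbTE ne23).
Qed.

End Inside.

(** * Dominated sets and ears *)

Section Dominators.
Variables (G : sgraph) (r : G).
Implicit Types (v w y z : G) (B : {set G}).

Lemma connect_adj_sym : connect_sym (@adj G).
Proof. by apply: sym_connect_sym; apply: adj_sym. Qed.

(** Dominators as in flow graphs: for [z != r], the reachable vertices that removing [z] cuts off
    from [r], including [z]. A firefighter on [z] saves them by itself ([dom_saved]). *)
Definition dom z : {set G} :=
  [set v | connect (@adj G) r v && ~~ connect (inside [set~ z]) r v].

Lemma dom_source z : r \notin dom z.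
Proof. by rewrite inE !connect0. Qed.

Lemma dom_reachable z v : v \in dom z -> connect (@adj G) r v.
Proof. by rewrite inE => /andP[]. Qed.

Lemma dom_refl z : z != r -> connect (@adj G) r z -> z \in dom z.
Proof.
move=> zr rz; rewrite inE rz /=; apply/negP=> /connect_inside_mem.
by rewrite !inE eqxx eq_sym => /(_ zr).
Qed.

Lemma dom_step z y y' :
  z != r -> y \in dom z -> y != z -> adj y y' -> y' \in dom z.
Proof.
move=> zr; rewrite !inE => /andP[ry nry] yz yy'.
rewrite (connect_trans ry (connect1 yy')) /=; apply: contra nry => ry'.
have y'z : y' \in [set~ z].
  by apply: connect_inside_mem ry'; rewrite !inE eq_sym.
apply: (connect_trans ry'); apply: connect1.
by rewrite /inside y'z inE in_set1 yz adj_sym.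
Qed.

Lemma dom_connected z v :
  z != r -> v \in dom z -> connect (inside (dom z)) z v.
Proof.
move=> zr vz; have := dom_reachable vz; move: v vz.
suff h v : connect (@adj G) r v ->
    v \in dom z -> connect (inside (dom z)) z v by move=> v vz /h; apply.
move: v; apply: connect_step_ind => [|y y' IH yy' y'd].
  by rewrite (negbTE (dom_source _)).
have [->//|y'z] := eqVneq y' z.
have yd : y \in dom z by apply: dom_step y'd y'z _; rewrite // adj_sym.
apply: (connect_trans (IH yd)); apply: connect1.
by rewrite /inside yd y'd.
Qed.

(** A walk leaves a dominated set only through its dominator. If neither vertex dominated the other,
    the walk from [p] back to [r] could leave neither set, although [r] belongs to none. *)
Lemma dom_chain z z' p :
  z != r -> z' != r -> p \in dom z -> p \in dom z' ->
  z' \in dom z \/ z \in dom z'.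
Proof.
move=> zr z'r pz pz'.
have [|nz'] := boolP (z' \in dom z); first by left.
have [|nz] := boolP (z \in dom z'); [by right | exfalso].
have : connect (@adj G) p r by rewrite connect_adj_sym; apply: dom_reachable pz.
suff h w : connect (@adj G) p w -> w \in dom z /\ w \in dom z'.
  by case/h; rewrite (negbTE (dom_source _)).
move: w; apply: connect_step_ind => [//|y y' [yz yz'] yy'].
split; apply: dom_step yy' => //.
  by apply: contraNneq nz => <-.
by apply: contraNneq nz' => <-.
Qed.

(** Every vertex on a path from [r] avoiding [z] is reached without [z], hence differs from [z']; so
    the path avoids [z'] too. *)
Lemma dom_sub z z' : z' \in dom z -> dom z' \subset dom z.
Proof.
move=> z'z; apply/subsetP=> v; rewrite !inE => /andP[-> nv] /=.
apply: contra nv.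
suff h w : connect (inside [set~ z]) r w ->
    connect (inside [set~ z]) r w /\ connect (inside [set~ z']) r w by case/h.
have ne y : connect (inside [set~ z]) r y -> y \in [set~ z'].
  rewrite !inE => ry; apply/eqP=> e; move: z'z.
  by rewrite inE -e ry andbF.
move: w; apply: connect_inside_ind => [//|y y' [ry ry'] yA y'A yy'].
have rz : connect (inside [set~ z]) r y'.
  by apply: (connect_trans ry); apply: connect1; rewrite /inside yA y'A.
split=> //; apply: (connect_trans ry'); apply: connect1.
by rewrite /inside !ne.
Qed.

Lemma dom_disjoint B z v :
  connected_set B -> r \in B -> z \notin B -> v \in dom z -> v \notin B.
Proof.
move=> cB rB zB; rewrite inE => /andP[_]; apply: contra => vB.
apply: connect_insideS (cB _ _ rB vB); apply/subsetP=> x xB.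
by rewrite !inE; apply: contraNneq zB => <-.
Qed.

Lemma dom_outer B z v :
  connected_set B -> r \in B -> z \notin B -> v \in dom z ->
  connect (inside (~: B)) z v.
Proof.
move=> cB rB zB vz.
have zr : z != r by apply: contraNneq zB => ->.
apply: connect_insideS (dom_connected zr vz).
by apply/subsetP=> x /(dom_disjoint cB rB zB) xB; rewrite inE.
Qed.

End Dominators.

(** * Structure of the components outside a connected set *)

Section Ears.
Variables (G : sgraph) (r : G) (B : {set G}).
Implicit Types (u : nat -> G) (l : nat).

(* The inner vertices are [u 1], ..., [u l]; the two end points [u 0] and
   [u l.+1] in [B] may coincide. *)
Record ear u l : Prop := Ear {
  ear_long : 1 < l;
  ear_start : u 0 \in B;
  ear_end : u l.+1 \in B;
  ear_out : forall j, 0 < j <= l -> u j \notin B;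
  ear_inj : forall i j, 0 < i <= l -> 0 < j <= l -> u i = u j -> i = j;
  ear_adj : forall j, j <= l -> adj (u j) (u j.+1) }.

Lemma ear_rev u l : ear u l -> ear (fun j => u (l.+1 - j)) l.
Proof.
case=> l1 u0 ul uo ui ua; split=> //; rewrite ?subn0 ?subnn //.
- by move=> j jl; apply: uo; lia.
- move=> i j il jl /ui e.
  have : l.+1 - i = l.+1 - j by apply: e; lia.
  by lia.
- move=> j jl; rewrite adj_sym.
  rewrite (_ : l.+1 - j = (l.+1 - j.+1).+1); last lia.
  by apply: ua; lia.
Qed.

Hypotheses (cactusG : cactus G) (cB : connected_set B) (rB : r \in B).

Definition ear_prefix u l i : {set G} := [set u j | j : 'I_l.+1 & 0 < j <= i].

(** With [ear_prefix], the pair of disjoint connected sets to which [cactus_cut] is applied. *)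
Definition ear_side u l i : {set G} :=
  [set y | connect (inside (~: ear_prefix u l i)) r y].

Lemma ear_prefixP u l i y : i <= l ->
  reflect (exists2 j, 0 < j <= i & y = u j) (y \in ear_prefix u l i).
Proof.
move=> il; apply: (iffP imsetP) => [[j]|[j ji ->]].
  by rewrite inE => ji ->; exists j.
have jl : j < l.+1 by lia.
by exists (Ordinal jl); rewrite ?inE.
Qed.

Lemma ear_prefix_out u l i : ear u l -> i <= l -> B \subset ~: ear_prefix u l i.
Proof.
move=> eu il; apply/subsetP=> x xB; rewrite inE; apply/negP=> /ear_prefixP.
case=> // j ji xj; move: (ear_out eu (j := j)); rewrite -xj xB.
by move=> h; have : false by apply: h; lia.
Qed.

Lemma ear_prefix_connected u l i :
  ear u l -> i <= l -> connected_set (ear_prefix u l i).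
Proof.
move=> eu il; apply: (@connected_from _ _ (u 1)) => y /ear_prefixP[] // j ji ->.
elim: j ji => // j IH ji; have [->//|j0] := eqVneq j 0.
apply: (connect_trans (IH _)); first lia.
apply: connect1; apply/and3P; split.
- by apply/ear_prefixP => //; exists j => //; lia.
- by apply/ear_prefixP => //; exists j.+1 => //; lia.
- by apply: (ear_adj eu); lia.
Qed.

Lemma mem_ear_side u l i j :
  ear u l -> i < j <= l.+1 -> u j \in ear_side u l i.
Proof.
move=> eu ij; have il : i <= l by lia.
have := subnKC (_ : j <= l.+1).
move: (l.+1 - j) => k; elim: k j ij => [|k IH] j ij.
  rewrite addn0 inE => ->; last lia.
  apply: connect_insideS (cB rB (ear_end eu)).
  exact: ear_prefix_out.
move=> e.
have : u j.+1 \in ear_side u l i by apply: IH; lia.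
rewrite !inE => h; apply: (connect_trans h); apply: connect1.
have nin k' : i < k' <= l.+1 -> u k' \notin ear_prefix u l i.
  move=> k'l; apply/negP=> /ear_prefixP[] // m mi um.
  have [ek|nk] := eqVneq k' l.+1.
    have := @ear_out _ _ eu m; rewrite -um ek (ear_end eu) => hh.
    by have : false by apply: hh; lia.
  by have := ear_inj eu _ _ um; lia.
rewrite /inside !inE !nin; [|lia..].
by rewrite adj_sym; apply: (ear_adj eu); lia.
Qed.

(** The edges from [u 1] to [u 0] and from [u i] to [u i.+1] already join the prefix to its far
    side. By [cactus_cut] the edge to [y] is one of them, the former only if [i = 1]. *)
Lemma ear_side_adj u l i y :
  ear u l -> 0 < i <= l -> adj (u i) y -> y \in ear_side u l i ->
  y = u i.-1 \/ y = u i.+1.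
Proof.
move=> eu il uy ys; have il' : i <= l by lia.
have rp : r \in ~: ear_prefix u l i by apply: (subsetP (ear_prefix_out eu il')).
have dis : [disjoint ear_prefix u l i & ear_side u l i].
  apply/pred0P=> x /=; apply/negbTE/negP=> /andP[xp]; rewrite inE.
  by move/(connect_inside_mem rp); rewrite inE xp.
have mp j : 0 < j <= i -> u j \in ear_prefix u l i.
  by move=> ji; apply/ear_prefixP => //; exists j.
have s0 : u 0 \in ear_side u l i.
  rewrite inE; apply: connect_insideS (cB rB (ear_start eu)).
  exact: ear_prefix_out.
have si : u i.+1 \in ear_side u l i by apply: mem_ear_side => //; lia.
(* Equality would give [i = 1] and [u 0 = u 2], but [1 < l] makes [u 2] an inner vertex, outside
   [B]. *)
have ne : (u 1, u 0) != (u i, u i.+1).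
  apply/eqP=> -[/(ear_inj eu) e1 e0].
  have i1 : 1 = i by apply: e1; lia.
  have := @ear_out _ _ eu i.+1; rewrite -e0 (ear_start eu) => h.
  by have : false by apply: h; have := ear_long eu; lia.
have a10 : adj (u 1) (u 0) by rewrite adj_sym (ear_adj eu).
have m1 : 0 < 1 <= i by lia.
have mi : 0 < i <= i by lia.
have [[/(ear_inj eu) e1 ->]|[->]] := cactus_cut cactusG dis
  (ear_prefix_connected eu il') (connected_component rp) (mp 1 m1) (mp i mi)
  (mp i mi) s0 si ys a10 (ear_adj eu il') uy ne.
- by left; rewrite e1 //; lia.
- by right.
Qed.

(* A vertex that the fire reaches without passing [u i] lies on the far side of
   one of the two halves [u 1 .. u i] and [u i .. u l] of the ear. *)
Lemma ear_step u l i y :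
  ear u l -> 0 < i <= l -> adj (u i) y ->
  [\/ y \in dom r (u i), y = u i.-1 | y = u i.+1].
Proof.
move=> eu il uy.
have [|yd] := boolP (y \in dom r (u i)); first by constructor 1.
pose u' j := u (l.+1 - j); have eu' := ear_rev eu; rewrite -/u' in eu'.
pose i' := l.+1 - i; have ui' : u' i' = u i by rewrite /u' /i'; congr u; lia.
have rui : connect (@adj G) r (u i).
  have : i <= l by lia.
  elim: i {il uy yd i' ui'} => [_|i IH il].
    by apply: connect_inside_adj (cB rB (ear_start eu)).
  apply: (connect_trans (IH _)); first lia.
  by apply: connect1; apply: (ear_adj eu); lia.
have : connect (inside [set~ u i]) r y.
  move: yd; rewrite inE negb_and negbK => /orP[|//].
  by rewrite (connect_trans rui (connect1 uy)).
(* A path avoiding [u i] leaves the side of one half only onto that half, at a vertex that lies on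
   the side of the other half. *)
have sides w : connect (inside [set~ u i]) r w ->
    w \in ear_side u l i \/ w \in ear_side u' l i'.
  move: w; apply: connect_inside_ind; first by left; rewrite inE.
  have half v l0 k w w' : ear v l0 -> 0 < k <= l0 ->
      w \in ear_side v l0 k -> w' != v k -> adj w w' ->
      w' \in ear_side v l0 k \/ exists2 j, 0 < j < k & w' = v j.
    move=> ev kl; rewrite !inE => rw w'v ww'.
    have [/ear_prefixP[] //|w'p] := boolP (w' \in ear_prefix v l0 k).
    - by lia.
    - move=> j jk w'j; right; exists j => //.
      suff : j <> k by lia.
      by move=> jk'; rewrite w'j jk' eqxx in w'v.
    - left; apply: (connect_trans rw); apply: connect1.
      rewrite /inside !inE w'p ww' !andbT.
      suff : w \in ~: ear_prefix v l0 k by rewrite inE.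
      apply: connect_inside_mem rw.
      by apply: (subsetP (ear_prefix_out ev _)); lia.
  move=> w w' [ws|ws] _; rewrite in_setC1 => w'u ww'.
    have [s|[j ji ->]] := half u l i w w' eu il ws w'u ww'.
      by left.
    right.
    have -> : u j = u' (l.+1 - j) by rewrite /u'; congr u; lia.
    by apply: mem_ear_side => //; rewrite /i'; lia.
  have il' : 0 < i' <= l by rewrite /i'; lia.
  rewrite -ui' in w'u; have [s|[j ji ->]] := half u' l i' w w' eu' il' ws w'u ww'.
  - by right.
  - by left; apply: mem_ear_side => //; rewrite /i' in ji *; lia.
move/sides=> [ys|ys].
  by case: (ear_side_adj eu il uy ys); [constructor 2|constructor 3].
rewrite -ui' in uy.
have il' : 0 < i' <= l by rewrite /i'; lia.
case: (ear_side_adj eu' il' uy ys) => ->.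
- by constructor 3; rewrite /u' /i'; congr u; lia.
- by constructor 2; rewrite /u' /i'; congr u; lia.
Qed.

Lemma ear_neq_source u l i : ear u l -> 0 < i <= l -> u i != r.
Proof. by move=> eu il; apply: contraNneq (ear_out eu il) => ->. Qed.

Lemma ear_reachable u l i : ear u l -> i <= l.+1 -> connect (@adj G) r (u i).
Proof.
move=> eu; elim: i => [_|i IH il].
  by apply: connect_inside_adj (cB rB (ear_start eu)).
apply: (connect_trans (IH _)); first lia.
by apply: connect1; apply: (ear_adj eu); lia.
Qed.

Lemma ear_mem_dom u l i : ear u l -> 0 < i <= l -> u i \in dom r (u i).
Proof.
move=> eu il; apply: dom_refl; first exact: (ear_neq_source eu).
by apply: (ear_reachable eu); lia.
Qed.

Lemma ear_connected u l i : ear u l -> 0 < i <= l ->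
  connect (inside (~: B)) (u 1) (u i).
Proof.
move=> eu; elim: i => // i IH il; have [->//|i0] := eqVneq i 0.
apply: (connect_trans (IH _)); first lia.
apply: connect1; rewrite /inside !inE !(ear_out eu); [|lia..].
by apply: (ear_adj eu); lia.
Qed.

(** By [ear_step] the union of the sets dominated by inner vertices is closed under steps outside
    [B]. *)
Lemma ear_region u l w : ear u l -> connect (inside (~: B)) (u 1) w ->
  exists2 i, 0 < i <= l & w \in dom r (u i).
Proof.
move=> eu; have l1 := ear_long eu; move: w.
apply: connect_inside_ind => [|y z [i il yi] yB zB yz].
  by exists 1; [lia|apply: (ear_mem_dom eu); lia].
have [e|ne] := eqVneq y (u i); last first.
  by exists i => //; apply: dom_step yi ne yz; apply: (ear_neq_source eu).
rewrite e in yz; case: (ear_step eu il yz) => h; first by exists i.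
- have zi : 0 < i.-1 <= l.
    suff : i.-1 <> 0 by lia.
    by move=> i0; rewrite h i0 inE (ear_start eu) in zB.
  by exists i.-1 => //; rewrite h; apply: (ear_mem_dom eu).
- have zi : 0 < i.+1 <= l.
    suff : i.+1 <> l.+1 by lia.
    by move=> i0; rewrite h i0 inE (ear_end eu) in zB.
  by exists i.+1 => //; rewrite h; apply: (ear_mem_dom eu).
Qed.

Lemma attached v : v \notin B -> connect (@adj G) r v ->
  exists x y, [/\ x \in B, y \notin B, adj x y & connect (inside (~: B)) y v].
Proof.
move=> vB rv; suff h w : connect (@adj G) r w -> w \in B \/
    exists x y, [/\ x \in B, y \notin B, adj x y & connect (inside (~: B)) y w].
  by case: (h v rv) => // vB'; rewrite vB' in vB.
move: w {rv vB v}; apply: connect_step_ind => [|w w' IH ww']; first by left.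
have [|w'B] := boolP (w' \in B); [by left | right].
case: IH => [wB|[x [y [xB yB xy yw]]]]; first by exists w, w'.
have [wB|wB] := boolP (w \in B); first by exists w, w'.
exists x, y; split=> //; apply: (connect_trans yw); apply: connect1.
by rewrite /inside !inE wB w'B.
Qed.

(** Fix one edge from [B] into the component, ending in [y1]. If another edge enters at a different
    vertex, a path between the two entries is an ear; otherwise [y1] dominates the component. *)
Lemma ear_or_gate v : v \notin B -> connect (@adj G) r v ->
  (exists u l, ear u l /\ connect (inside (~: B)) v (u 1)) \/
  (exists x z, [/\ x \in B, z \notin B, adj x z & v \in dom r z]).
Proof.
move=> vB rv; have [x1 [y1 [x1B y1B xy1 yv1]]] := attached vB rv.
have vy1 : connect (inside (~: B)) v y1 by rewrite connect_inside_sym.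
have y1C : y1 \in ~: B by rewrite inE.
case: (pickP [pred p : G * G | [&& p.1 \in B, p.2 != y1, adj p.1 p.2 &
    connect (inside (~: B)) v p.2]]) => [[x2 y2] /and4P[/= x2B ne xy2 vy2]|none].
  left; have : connect (inside (~: B)) y1 y2 by apply: connect_trans vy2.
  case/connectP=> p0 pp0 lp0; move: pp0 lp0 => /shortenP[p pp up _ lp].
  have [subp {}pp] := inside_path y1C pp.
  (* The default [x2] of [nth] supplies the far end [u l.+1]. *)
  exists (fun j => nth x2 (x1 :: y1 :: p) j), (size p).+1; split=> //.
  have mem j : 0 < j <= (size p).+1 -> nth x2 (x1 :: y1 :: p) j \in y1 :: p.
    by case: j => // j jl; exact: (@mem_nth _ x2 (y1 :: p) j).
  split=> //.
  - case: p lp {pp up subp mem} => //= lp.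
    by rewrite lp eqxx in ne.
  - by rewrite /= nth_default.
  - by move=> j /mem/subp; rewrite inE.
  - move=> [|i] // [|j] //= il jl e; congr _.+1.
    by apply/eqP; rewrite -(nth_uniq x2 _ _ up) ?e //; lia.
  - move=> [|j] /= jl; first exact: xy1.
    have [ej|nj] := eqVneq j (size p).
      rewrite [X in adj _ X]nth_default ?ej //.
      rewrite (_ : nth _ _ _ = y2) 1?adj_sym //.
      by rewrite lp (last_nth x2).
    have lt : j < size p by rewrite ltn_neqAle nj.
    exact: (pathP x2 pp).
right; exists x1, y1; split=> //; rewrite inE rv /=; apply/negP.
suff h w : connect (inside [set~ y1]) r w -> ~ connect (inside (~: B)) v w.
  by move/h; apply; apply: connect0.
move: w; apply: connect_inside_ind.
  have vC : v \in ~: B by rewrite inE.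
  by move/(connect_inside_mem vC); rewrite inE rB.
move=> w w' nw _; rewrite !inE => w'y ww' vw'.
have w'B : w' \notin B.
  suff : w' \in ~: B by rewrite inE.
  by apply: connect_inside_mem vw'; rewrite inE.
have [wB|wB] := boolP (w \in B).
  by have := none (w, w'); rewrite /= wB w'y ww' vw'.
apply: nw; apply: (connect_trans vw'); apply: connect1.
by rewrite /inside !inE wB w'B adj_sym.
Qed.

End Ears.

(** * Spread of the fire *)

Section Fire.
Variables (G : sgraph) (r : G).
Implicit Types (v w z : G) (s : nat -> {set G}) (f : nat -> nat).

Lemma protectedP s j v :
  reflect (exists2 i, i < j & v \in s i) (v \in protected s j).
Proof.
apply: (iffP idP) => [|[i ij vi]].
  elim: j => [|j IH] /=; first by rewrite inE.
  by rewrite inE => /orP[/IH[i ij vi]|vj]; [exists i => //; lia|exists j].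
elim: j ij => // j IH; rewrite ltnS leq_eqVlt /= inE => /predU1P[<-|/IH->//].
by rewrite vi orbT.
Qed.

Lemma protected_mono s i j : i <= j -> protected s i \subset protected s j.
Proof.
move=> ij; apply/subsetP=> v /protectedP[k ki vk].
by apply/protectedP; exists k => //; lia.
Qed.

Lemma burningSP s t v :
  reflect (v \in burning r s t \/ v \notin protected s t.+1 /\
            exists2 w, w \in burning r s t & adj w v)
          (v \in burning r s t.+1).
Proof.
rewrite [burning r s t.+1]/= in_setU inE; apply: (iffP orP).
  by case=> [|/andP[vp /exists_inP]]; [left|right].
by case=> [|[vp e]]; [left|right; apply/andP; split=> //; apply/exists_inP].
Qed.

Lemma burning_mono s i j : i <= j -> burning r s i \subset burning r s j.
Proof.
move=> ij; rewrite -(subnKC ij); elim: (j - i) => [|k IH]; first by rewrite addn0.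
apply: (subset_trans IH); rewrite addnS.
by apply/subsetP=> v vb; apply/burningSP; left.
Qed.

Lemma burning_le s i j v : i <= j -> v \in burning r s i -> v \in burning r s j.
Proof. by move=> ij; apply: subsetP (burning_mono s ij) v. Qed.

Lemma source_burning s t : r \in burning r s t.
Proof. by apply: (burning_le (leq0n t)); rewrite /= inE. Qed.

Lemma legal_protected f s i j v :
  legal r f s -> v \in protected s j -> v \notin burning r s i.
Proof.
move=> leg /protectedP[k kj vk].
have nk : v \notin burning r s k.
  have [_ dis] := leg k; have := disjointFr dis vk.
  by rewrite inE => /norP[].
have ki m : v \notin burning r s (k + m).
  elim: m => [|m IH]; first by rewrite addn0.
  rewrite addnS; apply/burningSP=> -[vb|[/negP[]]]; first by rewrite vb in IH.
  by apply/protectedP; exists k => //; lia.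
have := ki i; apply: contra; apply: burning_le; lia.
Qed.

Lemma savedP s v : reflect (forall i, v \notin burning r s i) (v \in saved r s).
Proof. by rewrite inE; apply: boolp.asboolP. Qed.

Lemma protected_saved f s j v :
  legal r f s -> v \in protected s j -> v \in saved r s.
Proof. by move=> leg vp; apply/savedP=> i; apply: legal_protected vp. Qed.

(** The unhindered fire, that is, the ball of radius [t] around [r] in graph distance. *)
Definition ball t := burning r (fun=> set0) t.

Lemma protected0 t : protected (fun=> set0) t = set0 :> {set G}.
Proof. by elim: t => //= t ->; rewrite setU0. Qed.

Lemma ballSP t v :
  reflect (v \in ball t \/ exists2 w, w \in ball t & adj w v) (v \in ball t.+1).
Proof.
apply: (iffP (burningSP _ t v)) => -[|h]; try by left.
  by right; case: h.
by right; rewrite protected0 inE.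
Qed.

Lemma ball_le i j v : i <= j -> v \in ball i -> v \in ball j.
Proof. exact: burning_le. Qed.

Lemma burning_ball s t : burning r s t \subset ball t.
Proof.
elim: t => // t /subsetP IH; apply/subsetP=> v /burningSP h.
apply/ballSP; case: h => [/IH|[_ [w /IH wb wv]]]; [by left|right].
by exists w.
Qed.

Lemma burning_quiet s t :
  (forall i, i < t -> s i = set0) -> burning r s t = ball t.
Proof.
elim: t => // t IH q; apply/setP=> v.
have p0 : protected s t.+1 = set0.
  apply/setP=> w; rewrite in_set0; apply/negbTE/protectedP=> -[i it].
  by rewrite q // inE.
have e : burning r s t = ball t by apply: IH => i it; apply: q; lia.
by apply/burningSP/ballSP; rewrite p0 e inE => -[h|h];
  [left|right; case: h|left|right].
Qed.

Lemma ball_connect t v : v \in ball t -> connect (inside (ball t)) r v.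
Proof.
elim: t v => [|t IH] v.
  by rewrite /ball /= inE => /eqP->.
have sub : ball t \subset ball t.+1 by apply: burning_mono.
move=> vb; case/ballSP: (vb) => [/IH|[w wb wv]]; first exact: connect_insideS.
apply: connect_trans (connect_insideS sub (IH _ wb)) _; apply: connect1.
by rewrite /inside (subsetP sub) // vb.
Qed.

Lemma ball_connected t : connected_set (ball t).
Proof. by apply: (@connected_from _ _ r) => v; apply: ball_connect. Qed.

Lemma ball_reachable t v : v \in ball t -> connect (@adj G) r v.
Proof. by move/ball_connect/connect_inside_adj. Qed.

Lemma burning_stop s t : burning r s t.+1 \subset burning r s t ->
  saved r s = ~: burning r s t.
Proof.
move=> /subsetP stop; apply/setP=> v; rewrite in_setC; apply/savedP/idP => [//|vt i].
suff h k w : w \in burning r s (t + k) -> w \in burning r s t.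
  apply: contra vt => vi; apply: (h i).
  by apply: burning_le vi; lia.
elim: k w => [|k IH] w; first by rewrite addn0.
rewrite addnS => /burningSP[/IH//|[wp [x /IH xb xw]]].
apply: stop; apply/burningSP; right; split; last by exists x.
by apply: contra wp; apply: (subsetP (protected_mono _ _)); lia.
Qed.

Lemma burning_stops s : exists2 t, t <= #|G| & burning r s t.+1 \subset burning r s t.
Proof.
suff h t : (exists2 k, k < t & burning r s k.+1 \subset burning r s k) \/
    t < #|burning r s t|.
  case: (h #|G|.+1) => [[k kG ks]|]; first by exists k.
  by rewrite ltnNge (leq_trans (max_card _)).
elim: t => [|t [[k kt ks]|IH]]; first by right; rewrite /= cards1.
  by left; exists k => //; lia.
have [st|nst] := boolP (burning r s t.+1 \subset burning r s t).
  by left; exists t.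
right; apply: leq_ltn_trans IH _; apply: proper_card.
by rewrite properE nst burning_mono.
Qed.

Lemma saved_late s t : #|G| <= t -> saved r s = ~: burning r s t.
Proof.
move=> Gt; have [k kG ks] := burning_stops s.
have e := burning_stop ks; rewrite e; apply/setP=> v; rewrite !in_setC.
congr negb; apply/idP/idP; first by apply: burning_le; lia.
move=> vt; apply/negPn/negP; rewrite -in_setC -e => /savedP/(_ t).
by rewrite vt.
Qed.

Lemma saved_exhausted s t :
  ~: burning r s t \subset protected s t.+1 -> saved r s = ~: burning r s t.
Proof.
move=> /subsetP sub; apply: burning_stop; apply/subsetP=> v.
case/burningSP => // -[vp _]; apply/negPn; rewrite -in_setC.
by apply: contra vp; apply: sub.
Qed.

(* If [z] burns [d] rounds late, then so does everything that the fire can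
   only reach through [z], as long as no firefighter stands behind [z]. *)
Lemma dom_delay s z t0 d T t v :
  z != r -> (forall t, z \in ball t -> t0 <= t) -> z \in burning r s (t0 + d) ->
  (forall p, p \in dom r z -> p \notin protected s T) ->
  v \in dom r z -> v \in ball t -> t + d <= T -> v \in burning r s (t + d).
Proof.
move=> zr zt0 zb np; elim: t v => [|t IH] v vz.
  by rewrite /ball /= inE => /eqP e; rewrite e (negbTE (dom_source _ _)) in vz.
move=> vb tT; have [vz'|nvz] := eqVneq v z.
  by rewrite vz' in vb *; apply: burning_le zb; rewrite leq_add2r; apply: zt0.
case/ballSP: vb => [vb|[w wb wv]].
  by apply: burning_le (IH _ vz vb _); lia.
rewrite addSn; apply/burningSP; right; split.
  apply: contra (np _ vz); apply: (subsetP (protected_mono _ _)); lia.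
exists w => //; apply: IH => //; last lia.
by apply: dom_step vz nvz _; rewrite // adj_sym.
Qed.

Lemma dom_ball z t v : z != r -> v \in dom r z -> v \in ball t -> z \in ball t.
Proof.
move=> zr; elim: t v => [|t IH] v vz.
  by rewrite /ball /= inE => /eqP e; rewrite e (negbTE (dom_source _ _)) in vz.
move=> vb; have [<-//|nvz] := eqVneq v z.
case/ballSP: vb => [vb|[w wb wv]]; apply: (@ball_le t) => //; first exact: IH vb.
by apply: IH wb; apply: dom_step vz nvz _; rewrite // adj_sym.
Qed.

Lemma ball_path t x p : x \in ball t -> path (@adj G) x p ->
  last x p \in ball (t + size p).
Proof.
elim: p x t => [|y p IH] x t xb /=; first by rewrite addn0.
case/andP=> xy; rewrite -addSnnS; apply: IH.
by apply/ballSP; right; exists x.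
Qed.

(** A simple path from [z] inside its dominated set has fewer edges than that set has vertices. *)
Lemma dom_depth z t v : z != r -> z \in ball t -> v \in dom r z ->
  v \in ball (t + #|dom r z|.-1).
Proof.
move=> zr zb vz.
have zz : z \in dom r z by apply: dom_refl => //; apply: ball_reachable zb.
case/connectP: (dom_connected zr vz) => p0 pp0 lp0.
move: pp0 lp0 => /shortenP[p pp up _ ->].
have [sub ap] := inside_path zz pp.
apply: ball_le (ball_path zb ap); rewrite leq_add2l.
suff : size (z :: p) <= #|dom r z| by rewrite /=; lia.
by rewrite -(card_uniqP up); apply: subset_leq_card; apply/subsetP=> x /sub.
Qed.

End Fire.

(** * Advance of the fire along an ear *)

Section EarFire.
Variables (G : sgraph) (r : G) (i1 : nat).
Hypothesis cactusG : cactus G.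
Let B := ball r i1.
Implicit Types (u : nat -> G) (s : nat -> {set G}) (f : nat -> nat).

Let cB : connected_set B := ball_connected (t := i1).
Let rB : r \in B := source_burning r _ i1.

(** Common induction step of [ear_calm], [ear_shield] and [ear_fence]: only the spine vertex [u j]
    has neighbours outside its dominated set, namely its two spine neighbours. *)
Lemma ear_fire_step (u : nat -> G) l (P : {set G}) j v :
  ear B u l -> 0 < j <= l -> v \in dom r (u j) ->
  (forall w, w \in dom r (u j) -> w \notin P) ->
  (v = u j -> u j.-1 \notin P /\ u j.+1 \notin P) ->
  ~ exists2 w, w \in P & adj w v.
Proof.
move=> eu jl vj nP nb [w wP wv].
have [e|ne] := eqVneq v (u j).
  have [n1 n2] := nb e; rewrite e adj_sym in wv.
  by case: (ear_step cactusG cB rB eu jl wv) => h;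
    [have := nP _ h|rewrite -h in n1|rewrite -h in n2]; rewrite ?wP // in n1 n2 *.
have wj : w \in dom r (u j).
  by apply: dom_step vj ne _; rewrite ?(ear_neq_source rB eu) // adj_sym.
by have := nP _ wj; rewrite wP.
Qed.

Lemma ear_out_dom u l j v : ear B u l -> 0 < j <= l -> v \in dom r (u j) ->
  v \notin B.
Proof. by move=> eu jl; apply: dom_disjoint => //; apply: (ear_out eu). Qed.

(** Fire enters an ear only at its two ends and advances at most one position per round; the two
    inequalities keep both fires short of [j]. *)
Lemma ear_calm u l j t v :
  ear B u l -> t < j -> j + t <= l -> v \in dom r (u j) -> v \notin ball r (i1 + t).
Proof.
move=> eu; elim: t j v => [|t IH] j v tj jtl vj.
  by rewrite addn0; apply: (ear_out_dom eu _ vj); lia.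
rewrite addnS; apply/ballSP=> -[vb|].
  by move: vb; apply/negP; apply: IH vj; lia.
have mem i : 0 < i <= l -> u i \in dom r (u i) by apply: (ear_mem_dom cB rB eu).
apply: (ear_fire_step eu _ vj); first lia.
- by move=> w; apply: IH; lia.
- by move=> _; split; [apply: (IH j.-1)|apply: (IH j.+1)]; try apply: mem; lia.
Qed.

Lemma ear_time u l j t : ear B u l -> 0 < j <= l -> u j \in ball r t ->
  i1 + minn j (l.+1 - j) <= t.
Proof.
move=> eu jl ub; rewrite leqNgt; apply/negP=> lt.
have uj : u j \in dom r (u j) by apply: (ear_mem_dom cB rB eu).
have := @ear_calm u l j (minn j (l.+1 - j)).-1 (u j) eu.
rewrite (ball_le _ ub); last lia.
by move=> h; suff : false by []; apply: h uj; lia.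
Qed.

(** Once [u i] is protected in time, only the fire from [u l.+1] threatens the positions beyond it,
    so of the two inequalities for position [j] in [ear_calm] only the second remains. *)
Lemma ear_shield s u l i T t j v :
  ear B u l -> T < i -> i + T <= l -> u i \in protected s (i1 + T).+1 ->
  T <= t -> i <= j -> j + t <= l -> v \in dom r (u j) ->
  v \notin burning r s (i1 + t).
Proof.
move=> eu Ti iTl up /subnKC <-; elim: (t - T) j v => [|k IH] j v ij jkl vj.
  rewrite addn0 in jkl *; apply: contra (ear_calm eu _ jkl vj); last lia.
  exact: (subsetP (burning_ball _ _ _)).
rewrite !addnS; apply/burningSP=> -[vb|[vp]].
  by move: vb; apply/negP; apply: IH vj; lia.
have mem m : 0 < m <= l -> u m \in dom r (u m) by apply: (ear_mem_dom cB rB eu).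
apply: (ear_fire_step eu _ vj); first lia.
- by move=> w; apply: IH; lia.
- move=> e; have ij' : i < j.
    rewrite ltn_neqAle ij andbT; apply: contraNneq vp => eij; rewrite e -eij.
    by apply: (subsetP (protected_mono _ _) _ up); lia.
  by split; [apply: (IH j.-1)|apply: (IH j.+1)]; try apply: mem; lia.
Qed.

(** A segment between two protected spine vertices is cut off for good if nothing in it burns yet.
    The case [i = k] covers a single target. *)
Lemma ear_fence s u l i k t j v :
  ear B u l -> 0 < i -> k <= l ->
  u i \in protected s t.+1 -> u k \in protected s t.+1 ->
  (forall j v, i <= j <= k -> v \in dom r (u j) -> v \notin burning r s t) ->
  i <= j <= k -> v \in dom r (u j) -> v \in saved r s.
Proof.
move=> eu i0 kl ui uk base ijk vj; apply/savedP=> m.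
suff h : v \notin burning r s (t + m).
  by apply: contra h; apply: burning_le; lia.
elim: m j v ijk vj => [|m IH] j v ijk vj; first by rewrite addn0; apply: base vj.
rewrite addnS; apply/burningSP=> -[vb|[vp]].
  by move: vb; apply/negP; apply: IH vj.
have mem a : 0 < a <= l -> u a \in dom r (u a) by apply: (ear_mem_dom cB rB eu).
apply: (ear_fire_step eu _ vj); first lia.
- by move=> w; apply: IH.
- move=> e.
  have pm : protected s t.+1 \subset protected s (t + m).+1.
    by apply: protected_mono; lia.
  have ij : i < j.
    rewrite ltn_neqAle; case/andP: ijk => -> _; rewrite andbT.
    by apply: contraNneq vp => eij; rewrite e -eij (subsetP pm).
  have jk : j < k.
    rewrite ltn_neqAle; case/andP: ijk => _ ->; rewrite andbT.
    by apply: contraNneq vp => eij; rewrite e eij (subsetP pm).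
  by split; [apply: (IH j.-1)|apply: (IH j.+1)]; try apply: mem; lia.
Qed.

(** Counterpart of [ear_calm]: the fire from [u l.+1] advances a full position per round while no
    firefighter stands beyond [q]. *)
Lemma ear_spread s u l q T i :
  ear B u l -> burning r s i1 = B ->
  (forall k, q < k <= l -> u k \notin protected s (i1 + T)) ->
  q < i -> i <= l.+1 -> l.+1 - i <= T -> u i \in burning r s (i1 + (l.+1 - i)).
Proof.
move=> eu bB np qi il; move e : (l.+1 - i) => k;
    elim: k i qi il e => [|k IH] i qi il e kT.
  by rewrite addn0 bB (_ : i = l.+1); [apply: (ear_end eu)|lia].
rewrite addnS; apply/burningSP; right; split.
  have : u i \notin protected s (i1 + T) by apply: np; lia.
  by apply: contra; apply: (subsetP (protected_mono _ _)); lia.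
exists (u i.+1); first by apply: IH; lia.
by rewrite adj_sym; apply: (ear_adj eu); lia.
Qed.

End EarFire.

(** * The online algorithm *)

Section Arrivals.
Variable f : nat -> nat.

(* Entry [x] is the round in which the [x]-th firefighter arrives. *)
Fixpoint arrivals t : seq nat :=
  if t is t'.+1 then arrivals t' ++ nseq (f t') t' else [::].

Lemma size_arrivalsS t : size (arrivals t.+1) = size (arrivals t) + f t.
Proof. by rewrite /= size_cat size_nseq. Qed.

Lemma arrivals_prefix t t' : t <= t' -> exists s, arrivals t' = arrivals t ++ s.
Proof.
move=> /subnKC <-; elim: (t' - t) => [|k [s IH]].
  by exists [::]; rewrite addn0 cats0.
by exists (s ++ nseq (f (t + k)) (t + k)); rewrite addnS /= IH catA.
Qed.

Lemma size_arrivals_mono t t' : t <= t' -> size (arrivals t) <= size (arrivals t').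
Proof. by case/arrivals_prefix=> s ->; rewrite size_cat leq_addr. Qed.

Lemma nth_arrivals d t t' x : t <= t' -> x < size (arrivals t) ->
  nth d (arrivals t') x = nth d (arrivals t) x.
Proof. by case/arrivals_prefix=> s -> xt; rewrite nth_cat xt. Qed.

(** The default [T] stands for an arrival in round [T] or later, which makes the equivalence valid
    for every [x]. *)
Lemma arrival_lt T t x : t <= T ->
  (nth T (arrivals T) x < t) = (x < size (arrivals t)).
Proof.
elim: T t => [|T IH] t; first by rewrite leqn0 => /eqP->.
move=> tT; rewrite [arrivals T.+1]/= nth_cat.
have [xT|Tx] := ltnP x (size (arrivals T)).
  rewrite (set_nth_default T) //.
  move: tT; rewrite leq_eqVlt => /predU1P[->|]; last by rewrite ltnS => /IH.
  have : nth T (arrivals T) x < T by rewrite IH.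
  by rewrite size_arrivalsS; lia.
rewrite nth_nseq; move: tT; rewrite leq_eqVlt => /predU1P[->|].
  by rewrite size_arrivalsS; case: ifP; lia.
rewrite ltnS => tT; have := size_arrivals_mono tT.
by case: ifP; lia.
Qed.

Lemma arrival_le T x : nth T (arrivals T) x <= T.
Proof.
have [xT|?] := ltnP x (size (arrivals T)); last by rewrite nth_default.
by apply: ltnW; rewrite arrival_lt.
Qed.

Lemma arrival_mono T x y : x <= y ->
  nth T (arrivals T) x <= nth T (arrivals T) y.
Proof.
move=> xy; rewrite leqNgt; apply/negP => h.
have := h; rewrite arrival_lt ?arrival_le // => /(leq_ltn_trans xy).
by rewrite -(arrival_lt _ (arrival_le T x)) ltnn.
Qed.

End Arrivals.

Lemma eq_arrivals f f' t :
  (forall i, i < t -> f i = f' i) -> arrivals f t = arrivals f' t.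
Proof. by elim: t => //= t IH e; rewrite IH ?e // => i it; apply: e; lia. Qed.

Lemma eq_protected (G : sgraph) (s s' : nat -> {set G}) t :
  (forall i, i < t -> s i = s' i) -> protected s t = protected s' t.
Proof. by elim: t => //= t IH e; rewrite IH ?e // => i it; apply: e; lia. Qed.

Lemma eq_burning (G : sgraph) (r : G) (s s' : nat -> {set G}) t :
  (forall i, i < t -> s i = s' i) -> burning r s t = burning r s' t.
Proof.
elim: t => // t IH e.
rewrite [LHS]/= [RHS]/= IH; last by move=> i it; apply: e; lia.
by rewrite (@eq_protected _ s s' t) ?e // => i it; apply: e; lia.
Qed.

Lemma legal_card (G : sgraph) (r : G) f (s : nat -> {set G}) t : legal r f s ->
  #|protected s t.+1| = #|protected s t| + #|s t|.
Proof.
move=> leg; rewrite /= cardsU; have [_ dis] := leg t.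
rewrite (_ : _ :&: _ = set0) ?cards0 ?subn0 //.
apply/eqP; rewrite setI_eq0 disjoint_sym; apply: disjointWr dis.
exact: subsetUr.
Qed.

Section Fill.
Variables (T : finType) (m : nat) (D A : {set T}).

(** Desired vertices come first, then arbitrary available ones, so that no firefighter is wasted. *)
Definition fill : {set T} := [set x in take m (enum (D :&: A) ++ enum (A :\: D))].

Let s := enum (D :&: A) ++ enum (A :\: D).

Let mem_s x : (x \in s) = (x \in A).
Proof. by rewrite /s mem_cat !mem_enum !inE; case: (x \in D); case: (x \in A). Qed.

Let uniq_s : uniq s.
Proof.
rewrite cat_uniq !enum_uniq andbT /=; apply/hasPn=> x.
by rewrite !mem_enum !inE; case: (x \in D).
Qed.

Lemma fill_sub : fill \subset A.
Proof. by apply/subsetP=> x; rewrite inE => /mem_take; rewrite mem_s. Qed.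

Lemma card_fill : #|fill| = minn m #|A|.
Proof.
rewrite cardsE (card_uniqP (take_uniq _ uniq_s)) size_take_min; congr minn.
by rewrite -(card_uniqP uniq_s); apply: eq_card => x; rewrite mem_s.
Qed.

Lemma fill_desired : #|D| <= m -> D :&: A \subset fill.
Proof.
move=> Dm; apply/subsetP=> x xD; rewrite inE take_cat -cardE.
case: ifP => _; last by rewrite mem_cat mem_enum xD.
rewrite take_oversize ?mem_enum // -cardE (leq_trans _ Dm) //.
by apply: subset_leq_card; apply: subsetIl.
Qed.

End Fill.

(** * Choice of the ears and definition of the moves *)

Section Algorithm.
Variables (G : sgraph) (r : G).

Section Canonical.
Variable i1 : nat.

Definition outer := inside (~: ball r i1).
Definition region (c : G) : {set G} :=
  [set v | (v \notin ball r i1) && (fingraph.root outer v == c)].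

Definition is_ear_of c (ul : (nat -> G) * nat) :=
  ear (ball r i1) ul.1 ul.2 /\ fingraph.root outer (ul.1 1) = c.

(** One ear is fixed for each component, named by its root; length [0] marks a component without
    ear. *)
Definition ear_of c : (nat -> G) * nat :=
  if boolp.pselect (exists ul, is_ear_of c ul) is left h
  then sval (boolp.cid h) else (fun=> r, 0).

Definition ear_size c := (ear_of c).2.

(** The flag [b] reverses the ear, so that positions can be counted from either end. *)
Definition spine c (b : bool) j :=
  (ear_of c).1 (if b then (ear_size c).+1 - j else j).

Lemma outer_sym : connect_sym outer.
Proof. exact: connect_inside_sym. Qed.

Lemma ear_size_gt0 c : 0 < ear_size c -> is_ear_of c (ear_of c).
Proof.
rewrite /ear_size /ear_of; case: boolp.pselect => // h _.
exact: (svalP (boolp.cid h)).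
Qed.

Lemma exists_ear c ul : is_ear_of c ul -> 0 < ear_size c.
Proof.
rewrite /ear_size /ear_of => h; case: boolp.pselect => [h'|]; last first.
  by case; exists ul.
have [e _] := svalP (boolp.cid h').
exact: ltnW (ear_long e).
Qed.

Lemma spine_ear c b : 0 < ear_size c -> ear (ball r i1) (spine c b) (ear_size c).
Proof.
by move/ear_size_gt0=> [e _]; case: b; [exact: (ear_rev e)|exact: e].
Qed.

Lemma spine_region c b j : 0 < j <= ear_size c -> spine c b j \in region c.
Proof.
move=> jl; have l0 : 0 < ear_size c by lia.
have [e ec] := ear_size_gt0 l0; rewrite inE -[X in _ == X]ec /spine.
have -> : (ear_of c).1 (if b then (ear_size c).+1 - j else j) \notin ball r i1.
  by apply: (ear_out e); rewrite -/(ear_size c); case: b; lia.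
apply/eqP/(fingraph.rootP outer_sym); rewrite outer_sym.
by apply: (ear_connected (source_burning r _ i1) e); rewrite -/(ear_size c);
    case: b; lia.
Qed.

Lemma spine_rev c b j : j <= (ear_size c).+1 ->
  spine c b ((ear_size c).+1 - j) = spine c (~~ b) j.
Proof. by move=> jl; rewrite /spine; case: b => //=; congr ((ear_of c).1 _); lia. Qed.

Definition candidate := (G * bool * 'I_#|G|.+1)%type.

Definition target (k : candidate) := spine k.1.1 k.1.2 k.2.

(* Closing the ear in the [T]-th round saves at least the set dominated by the
   target and the spine vertices in between, hence a third of [score - T]. *)
Definition score (k : candidate) :=
  ((ear_size k.1.1).+1 - k.2) + 2 * #|dom r (target k)|.

(** The inequalities are those of [ear_calm]: [T] rounds after [i1] neither fire has reached the
    target. *)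
Definition eligible T (used : seq G) (k : candidate) :=
  [&& T < k.2, k.2 + T <= ear_size k.1.1 & k.1.1 \notin used].

Definition best T used : option candidate :=
  [pick k | eligible T used k &&
    [forall k', eligible T used k' ==> (score k' <= score k)]].

Lemma best_some T used k : best T used = Some k ->
  eligible T used k /\ forall k', eligible T used k' -> score k' <= score k.
Proof.
rewrite /best; case: pickP => // k' /andP[ek /forallP h] [<-]; split=> // k''.
by move=> e; apply: (implyP (h k'')).
Qed.

Lemma best_exists T used k : eligible T used k -> exists k', best T used = Some k'.
Proof.
move=> ek; rewrite /best; case: pickP => [k' _|none]; first by exists k'.
have := none [arg max_(i > k | eligible T used i) score i].
case: arg_maxnP => // k' ek' max; rewrite ek' /= => /negbT/negP[].
by apply/forallP=> k''; apply/implyP/max.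
Qed.

(* The firefighters numbered [2 m] and [2 m + 1] open and close an ear. *)
Fixpoint used (a : seq nat) m : seq G :=
  if m is m'.+1 then
    if best (nth 0 a m'.*2 - i1) (used a m') is Some k
    then k.1.1 :: used a m' else used a m'
  else [::].

Definition opening a m := best (nth 0 a m.*2 - i1) (used a m).

Lemma usedP a m c :
  reflect (exists m' k, [/\ m' < m, opening a m' = Some k & k.1.1 = c])
          (c \in used a m).
Proof.
elim: m => [|m IH] /=; first by constructor=> -[m' [k []]].
rewrite -/(opening a m); case e: (opening a m) => [k|].
  rewrite inE; apply: (iffP predU1P) => [[->|/IH[m' [k' [mm o kc]]]]|].
  - by exists m, k.
  - by exists m', k'; split=> //; lia.
  - case=> m' [k' [mm o kc]]; have [em|nm] := eqVneq m' m.
      by left; move: o; rewrite em e => -[->].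
    by right; apply/IH; exists m', k'; split=> //; lia.
apply: (iffP IH) => -[m' [k' [mm o kc]]]; exists m', k'; split=> //; first lia.
by have [em|nm] := eqVneq m' m; [rewrite em e in o|lia].
Qed.

(** An opening looks only at arrivals up to number [2 m], so it can be computed online. *)
Lemma eq_opening a a' m : (forall x, x <= m.*2 -> nth 0 a x = nth 0 a' x) ->
  opening a m = opening a' m.
Proof.
move=> e; rewrite /opening e //; congr best.
elim: m e => //= m IH e; rewrite e ?IH //; last lia.
by move=> x xm; apply: e; lia.
Qed.

(* The closing position is the last one that the fire from the far end has not
   reached. It is a junk value when the ear is already lost, but then it only
   competes with the other free vertices in [move_in]. *)
Definition request a x t : option G :=
  if opening a x./2 is Some k then
    Some (if odd x then spine k.1.1 k.1.2 (ear_size k.1.1 - (t - i1)) else target k)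
  else None.

(** The condition [|dom r z| >= sqrt n / 3], squared to stay within the natural numbers. *)
Definition gate z := (z \notin ball r i1) && (#|G| <= 9 * #|dom r z| ^ 2).

End Canonical.

Variable f : nat -> nat.

(** The head of the arrival list is the round of the first arrival. Before that round [f t = 0], and
    the set is empty whatever the default. *)
Definition desired t : {set G} :=
  let a := arrivals f t.+1 in let i1 := head 0 a in
  if [pick z | gate i1 z] is Some z then
    if (t == i1) && (0 < f t) then [set z] else set0
  else [set v in pmap (request i1 a ^~ t) (iota (size (arrivals f t)) (f t))].

Lemma card_desired t : #|desired t| <= f t.
Proof.
rewrite /desired; case: pickP => [z _|_].
  by case: ifP => [/andP[_]|]; rewrite ?cards1 ?cards0.
rewrite cardsE (leq_trans (card_size _)) // size_pmap.
by rewrite (leq_trans (count_size _ _)) // size_iota.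
Qed.

Definition available (s : nat -> {set G}) t := ~: (burning r s t :|: protected s t).

Definition move_in t s := fill (f t) (desired t) (available s t).

(** Course-of-values recursion, as a move depends on all earlier ones through [available];
    [strategyE] is the resulting fixed-point equation. *)
Fixpoint history t : seq {set G} :=
  if t is t'.+1 then rcons (history t') (move_in t' (nth set0 (history t')))
  else [::].

Definition strategy t := move_in t (nth set0 (history t)).

Lemma size_history t : size (history t) = t.
Proof. by elim: t => //= t IH; rewrite size_rcons IH. Qed.

Lemma nth_history t i : i < t -> nth set0 (history t) i = strategy i.
Proof.
elim: t => // t IH; rewrite ltnS /= nth_rcons size_history leq_eqVlt.
by case/predU1P=> [->|it]; [rewrite ltnn eqxx|rewrite it IH].
Qed.

Lemma strategyE t : strategy t = move_in t strategy.
Proof.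
have e i : i < t -> nth set0 (history t) i = strategy i := @nth_history t i.
transitivity (move_in t (nth set0 (history t))) => //.
by rewrite /move_in /available (eq_burning r e) (eq_protected e).
Qed.

Lemma strategy_legal : legal r f strategy.
Proof.
move=> t; rewrite strategyE /move_in; split.
  by rewrite card_fill geq_minl.
have := fill_sub (f t) (desired t) (available strategy t).
by rewrite /available disjoints_subset.
Qed.

Lemma strategy_requested t v : v \in desired t -> v \notin burning r strategy t ->
  v \in protected strategy t.+1.
Proof.
move=> vd vb; have [vp|vp] := boolP (v \in protected strategy t).
  by apply: (subsetP (protected_mono _ (leqnSn t))).
rewrite /= inE; apply/orP; right; rewrite strategyE.
apply: (subsetP (fill_desired _ (card_desired t))).
by rewrite !inE vd negb_or vb.
Qed.

End Algorithm.

Lemma eq_strategy (G : sgraph) (r : G) f f' t :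
  (forall i, i <= t -> f i = f' i) -> strategy r f t = strategy r f' t.
Proof.
have em t' s : (forall i, i <= t' -> f i = f' i)
    -> move_in r f t' s = move_in r f' t' s.
  move=> e; have ea : arrivals f t' = arrivals f' t'.
    by apply: eq_arrivals => i it; apply: e; lia.
  by rewrite /move_in /desired /= ea !e.
move=> e; have eh : history r f t = history r f' t.
  elim: t e => [//|t IH] e; have e' i : i <= t -> f i = f' i.
    by move=> it; apply/e/(leq_trans it).
  by rewrite [LHS]/= [RHS]/= (IH e') (em _ _ e').
by rewrite /strategy eh (em _ _ e).
Qed.

(** The revealed list is padded with zeros; by [eq_strategy] the padding does not affect the current
    move. *)
Definition pairing_rule : decision_rule :=
  fun G r s => strategy r (nth 0 s) (size s).-1.

Lemma play_pairing (G : sgraph) (r : G) f : play pairing_rule r f =1 strategy r f.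
Proof.
move=> t; rewrite /play /pairing_rule size_mkseq; apply: eq_strategy => i it.
by rewrite nth_mkseq.
Qed.

Lemma saved_ext (G : sgraph) (r : G) s s' : s =1 s' -> saved r s = saved r s'.
Proof.
move=> e; apply/setP=> v.
by apply/savedP/savedP => h i; rewrite ?(eq_burning r (fun j _ => e j))
  // -?(eq_burning r (fun j _ => e j)).
Qed.

Lemma pairing_online : online_algorithm pairing_rule.
Proof.
move=> G r f t; rewrite play_pairing; have [c dis] := strategy_legal r f t.
split=> //.
by rewrite (eq_burning r (fun j _ => play_pairing r f j))
  (eq_protected (fun j _ => play_pairing r f j)).
Qed.

(** * The gain of the algorithm *)

Section Gain.
Variables (G : sgraph) (r : G) (f : nat -> nat) (i1 : nat).
Hypotheses (cactusG : cactus G) (f_i1 : 0 < f i1).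
Hypothesis quiet : forall t, t < i1 -> f t = 0.
Hypothesis no_gate : forall z, ~~ gate r i1 z.

Let S := strategy r f.
Let B := ball r i1.
Let cB : connected_set B := ball_connected (t := i1).
Let rB : r \in B := source_burning r _ i1.

(* The game is decided in this round: either every available vertex can be protected
   or the fire has already stopped. *)
Definition last_round :=
  find (fun t => #|available r S t| < f t) (iota 0 (i1 + #|G|).+1).

Local Notation J := last_round.

(** By the default, a firefighter not arriving before [J] counts as arriving in round [J], when the
    outcome is settled. *)
Definition arrival x := nth J (arrivals f J) x.

Lemma find_iota_lt (p : pred nat) n t : t < find p (iota 0 n) -> ~~ p t.
Proof.
move=> tf; have := before_find 0 tf; rewrite nth_iota ?add0n => [->//|].
by apply: leq_trans tf _; rewrite -[X in _ <= X](size_iota 0) find_size.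
Qed.

Lemma find_iota_eq (p : pred nat) n : find p (iota 0 n) < n -> p (find p (iota 0 n)).
Proof.
move=> fn; have h : has p (iota 0 n) by rewrite has_find size_iota.
by have := nth_find 0 h; rewrite nth_iota.
Qed.

Lemma first_le_last : i1 <= J.
Proof.
rewrite leqNgt; apply/negP=> Ji.
have JN : J < (i1 + #|G|).+1 by lia.
by have := find_iota_eq JN; rewrite -/J quiet.
Qed.

Lemma strategy_full t : t < J -> #|S t| = f t.
Proof.
move/find_iota_lt; rewrite -leqNgt => h.
by rewrite /S strategyE card_fill; apply/minn_idPl.
Qed.

Lemma saved_last : saved r S = ~: burning r S J.
Proof.
have [JN|NJ] := ltnP J (i1 + #|G|).+1; last by apply: saved_late; lia.
have := find_iota_eq JN; rewrite -/J => h.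
apply: saved_exhausted; apply/subsetP=> v; rewrite in_setC => vb /=.
rewrite inE; have [//|vp] := boolP (v \in protected S J).
have SJ : S J = available r S J.
  apply/eqP; rewrite eqEcard /S [strategy r f J]strategyE fill_sub.
  by rewrite card_fill leq_min leqnn (ltnW h).
by rewrite SJ /available !inE negb_or vb.
Qed.

Lemma card_protected t : t <= J -> #|protected S t| = size (arrivals f t).
Proof.
elim: t => [|t IH] tJ; first by rewrite cards0.
rewrite (legal_card _ (strategy_legal r f)) size_arrivalsS IH; last lia.
by rewrite -/S strategy_full.
Qed.

(** Before [J] every firefighter occupies a vertex, thanks to [fill]. This bound later pays for the
    sheltered vertices. *)
Lemma firefighters_le_saved : size (arrivals f J) <= #|saved r S|.
Proof.
rewrite -card_protected //; apply: subset_leq_card; apply/subsetP=> v.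
exact: protected_saved (strategy_legal r f).
Qed.

Lemma arrivals_first : arrivals f i1 = [::].
Proof.
elim: {-2}i1 (leqnn i1) => //= t IH ti.
by rewrite IH ?quiet //; lia.
Qed.

Lemma arrival_ge x : i1 <= arrival x.
Proof.
by rewrite leqNgt /arrival arrival_lt ?arrivals_first // first_le_last.
Qed.

Lemma arrival_nth0 x : x < size (arrivals f J) -> nth 0 (arrivals f J) x = arrival x.
Proof. by move=> xJ; apply: set_nth_default. Qed.

Lemma head_arrivals t : i1 <= t -> head 0 (arrivals f t.+1) = i1.
Proof.
move=> it; have /(arrivals_prefix f)[s ->] : i1.+1 <= t.+1 by [].
by rewrite /= arrivals_first; case: (f i1) f_i1.
Qed.

(** The request read off the whole list up to [J] agrees with the one computed online, by
    [eq_opening]. *)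
Lemma request_protected x v : x < size (arrivals f J) ->
  request r i1 (arrivals f J) x (arrival x) = Some v ->
  v \notin burning r S (arrival x) -> v \in protected S (arrival x).+1.
Proof.
move=> xJ; set t := arrival x => rv vb.
have tJ : t < J by rewrite /t /arrival arrival_lt.
have x1 : x < size (arrivals f t.+1) by rewrite -(arrival_lt _ (T := J)).
have x0 : size (arrivals f t) <= x.
  by rewrite leqNgt -(arrival_lt _ (T := J)) ?ltnn //; lia.
apply: strategy_requested vb; rewrite /desired head_arrivals ?arrival_ge //.
case: pickP => [z gz|_]; first by have := no_gate z; rewrite gz.
rewrite inE mem_pmap; apply/mapP; exists x.
  by rewrite mem_iota x0 -size_arrivalsS.
rewrite -rv /request; rewrite (@eq_opening _ _ _ (arrivals f J) (arrivals f t.+1)) //.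
move=> y yx; apply: nth_arrivals => //; apply: leq_ltn_trans x1.
by apply: (leq_trans yx); rewrite -{2}[x]odd_double_half leq_addl.
Qed.

Lemma dom_region c b j v : 0 < j <= ear_size r i1 c ->
  v \in dom r (spine r i1 c b j) -> v \in region r i1 c.
Proof.
move=> jl vj; have := spine_region b jl; rewrite !inE => /andP[uB /eqP uc].
rewrite (dom_disjoint cB rB uB vj) /= -[X in _ == X]uc.
apply/eqP/(fingraph.rootP (@outer_sym _ r i1)); rewrite outer_sym.
exact: dom_outer uB vj.
Qed.

(** A third of this bounds from below what pair [m] saves in its ear; the score is reduced by the
    delay of the closing firefighter. *)
Definition gap m :=
  if opening r i1 (arrivals f J) m is Some k
  then score r i1 k - (arrival m.*2.+1 - i1) else 0.

(** Both the set dominated by the target and the closed spine segment lie in the saved part of the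
    region. The score counts the former twice and the latter once, hence the factor 3. *)
Lemma gap_le_saved m k : m.*2 < size (arrivals f J) ->
  opening r i1 (arrivals f J) m = Some k ->
  gap m <= 3 * #|region r i1 k.1.1 :&: saved r S|.
Proof.
move=> mJ ok; rewrite /gap ok; have := ok; rewrite /opening arrival_nth0 //.
case/best_some; rewrite /eligible => /and3P[].
set T := _ - i1; set T' := _ - i1.
set c := k.1.1; set b := k.1.2; set j : nat := k.2; set l := ear_size r i1 c.
move=> Tj jTl _ _.
have l0 : 0 < ear_size r i1 c by rewrite -/l; lia.
have eu : ear B (spine r i1 c b) l := spine_ear b l0.
set u := spine r i1 c b in eu.
have eT : i1 + T = arrival m.*2 by rewrite /T subnKC // arrival_ge.
have eT' : i1 + T' = arrival m.*2.+1 by rewrite /T' subnKC // arrival_ge.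
have TT' : T <= T'.
  by apply: leq_sub2r; apply: arrival_mono.
have memd i : 0 < i <= l -> u i \in dom r (u i) by apply: (ear_mem_dom cB rB eu).
have calm i v : T < i -> i + T <= l -> v \in dom r (u i)
    -> v \notin burning r S (i1 + T).
  move=> Ti iT /(ear_calm cactusG eu Ti iT).
  by apply: contra; apply: (subsetP (burning_ball _ _ _)).
have jp : u j \in protected S (i1 + T).+1.
  rewrite eT; apply: request_protected => //; last first.
    by rewrite -eT; apply: (calm j) => //; apply: memd; lia.
  by rewrite /request odd_double doubleK ok.
have sj v : v \in dom r (u j) -> v \in saved r S.
  apply: (ear_fence cactusG eu _ _ jp jp); [lia|lia| |lia].
  by move=> i w ij; apply: calm; lia.
have dj : #|dom r (u j)| <= #|region r i1 c :&: saved r S|.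
  apply: subset_leq_card; apply/subsetP=> v vj; rewrite in_setI sj // andbT.
  by apply: dom_region vj; lia.
have si i : j <= i -> i + T' <= l -> u i \in saved r S.
  move=> ji iT'; have ui : u i \in dom r (u i) by apply: memd; lia.
  have shield n v : j <= n -> n + T' <= l -> v \in dom r (u n) ->
      v \notin burning r S (i1 + T').
    by move=> jn nT'; apply: (ear_shield cactusG eu Tj jTl jp).
  (* A closing firefighter that comes before [J] fences the segment. Otherwise its arrival is [J] by
     default, and what is not burning then is saved. *)
  have [aJ|Ja] := ltnP m.*2.+1 (size (arrivals f J)).
    have lp : u (l - T') \in protected S (i1 + T').+1.
      rewrite eT'; apply: request_protected => //; last first.
        by rewrite -eT'; apply: (shield (l - T')); [lia|lia|apply: memd; lia].
      by rewrite /request /= odd_double uphalf_double ok.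
    apply: (@ear_fence _ _ _ cactusG S u l j (l - T') (i1 + T') i _ eu _ _ _ lp _ _ ui);
      [lia|lia| | |lia].
      by apply: (subsetP (protected_mono _ _) _ jp); lia.
    by move=> n v nn; apply: shield; lia.
  rewrite saved_last inE; have -> : J = i1 + T' by rewrite eT' /arrival nth_default.
  exact: shield ui.
have cj : l.+1 - T' - j <= #|region r i1 c :&: saved r S|.
  pose s := [seq u i | i <- iota j (l.+1 - T' - j)].
  have us : uniq s.
    rewrite map_inj_in_uniq ?iota_uniq // => x y; rewrite !mem_iota => xj yj.
    by apply: (ear_inj eu); lia.
  rewrite -(size_iota j (_ - j)) -(size_map u) -(card_uniqP us).
  apply: subset_leq_card; apply/subsetP=> v /mapP[i]; rewrite mem_iota => ij ->.
  by rewrite in_setI si ?spine_region ?andbT //; lia.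
rewrite /score -/c -/j -/l /target -/c -/b -/j -/u; lia.
Qed.

(** No ear is opened twice, so the pairs save vertices in disjoint regions. The last pair may
    consist of one firefighter only. *)
Lemma sum_gap_le M : M.*2 <= (size (arrivals f J)).+1 ->
  \sum_(m < M) gap m <= 3 * #|saved r S|.
Proof.
move=> MJ; pose g (m : 'I_M) := 
  if opening r i1 (arrivals f J) m is Some k then region r i1 k.1.1 :&: saved r S
  else set0.
have gg (m : 'I_M) : gap m <= 3 * #|g m|.
  rewrite /g; case e : (opening _ _ _ _) => [k|]; last by rewrite /gap e.
  by apply: gap_le_saved => //; have := ltn_ord m; lia.
apply: (@leq_trans (\sum_(m < M) 3 * #|g m|)).
  by apply: leq_sum => m _; apply: gg.
rewrite -big_distrr /= leq_mul2l /=.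
have dis (m m' : 'I_M) v : v \in g m -> v \in g m' -> m = m'.
  rewrite /g; case e : (opening _ _ _ m) => [k|]; last by rewrite inE.
  case e' : (opening _ _ _ m') => [k'|]; last by rewrite !inE.
  rewrite !inE => /andP[/andP[_ /eqP vk] _] /andP[/andP[_ /eqP vk'] _].
  have kk : k.1.1 = k'.1.1 by rewrite -vk -vk'.
  have clash (a a' : nat) ka ka' : a < a' ->
      opening r i1 (arrivals f J) a = Some ka ->
      opening r i1 (arrivals f J) a' = Some ka' -> ka.1.1 <> ka'.1.1.
    move=> aa ea ea' ee; move: ea'; rewrite /opening => /best_some[].
    case/and3P=> _ _ /negP h _; apply: h; rewrite -ee.
    by apply/usedP; exists a, ka.
  apply/val_inj; case: (ltngtP m m') => // lt.
    by case: (clash _ _ _ _ lt e e').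
  by case: (clash _ _ _ _ lt e' e).
apply: (@leq_trans #|\bigcup_m g m|); last first.
  apply: subset_leq_card; apply/bigcupsP=> m _; rewrite /g.
  by case: (opening _ _ _ _) => [k|]; [apply: subsetIr|apply: sub0set].
rewrite -sum1_card -(eq_bigr _ (fun m _ => sum1_card (mem (g m)))).
rewrite (partition_disjoint_bigcup _ (fun=> 1)) //.
move=> m m' ne; apply/pred0P=> v /=; apply/negbTE/negP=> /andP[h h'].
by rewrite (dis _ _ _ h h') eqxx in ne.
Qed.

End Gain.

(** * Comparison with an offline strategy *)

Lemma card_bigcup_le (T I : finType) (P : pred I) (F : I -> {set T}) :
  #|\bigcup_(i | P i) F i| <= \sum_(i | P i) #|F i|.
Proof.
elim/big_rec2: _ => [|i A m _ mA]; first by rewrite cards0.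
by rewrite (leq_trans (leq_card_setU _ _).1) // leq_add2l.
Qed.

Section Placements.
Variables (G : sgraph) (s : nat -> {set G}).

(** Vertices in order of placement, so that [index] numbers the offline firefighters; the order
    within a round is arbitrary. *)
Fixpoint placements t : seq G :=
  if t is t'.+1 then placements t' ++ enum (s t') else [::].

Lemma mem_placements t v : (v \in placements t) = (v \in protected s t).
Proof. by elim: t => [|t IH] /=; rewrite ?inE // mem_cat IH mem_enum. Qed.

Lemma placements_prefix t t' : t <= t' -> exists p, placements t' = placements t ++ p.
Proof.
move=> /subnKC <-; elim: (t' - t) => [|k [p IH]].
  by exists [::]; rewrite addn0 cats0.
by exists (p ++ enum (s (t + k))); rewrite addnS /= IH catA.
Qed.

Lemma index_placements t t' v : t <= t' -> v \in protected s t ->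
  index v (placements t') < size (placements t).
Proof.
move=> /placements_prefix[p ->]; rewrite -mem_placements => vt.
by rewrite index_cat vt index_mem.
Qed.

Lemma nth_placements d t t' x : t <= t' -> x < size (placements t) ->
  nth d (placements t') x \in protected s t.
Proof.
move=> /placements_prefix[p ->] xt.
by rewrite nth_cat xt -mem_placements mem_nth.
Qed.

Lemma size_placements r f t : legal r f s -> size (placements t) <= size (arrivals f t).
Proof.
move=> leg; elim: t => // t IH; rewrite size_arrivalsS /= size_cat -cardE.
by apply: leq_add => //; have [] := leg t.
Qed.

End Placements.

(** * Charging the losses against an offline strategy *)

Section Offline.
Variables (G : sgraph) (r : G) (f : nat -> nat) (i1 tau : nat) (s : nat -> {set G}).
Hypotheses (cactusG : cactus G) (f_i1 : 0 < f i1).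
Hypothesis quiet : forall t, t < i1 -> f t = 0.
Hypothesis no_gate : forall z, ~~ gate r i1 z.
Hypothesis dom_le : forall z, z \notin ball r i1 -> #|dom r z| <= tau.
Hypothesis legal_s : legal r f s.

Let S := strategy r f.
Let B := ball r i1.
Let cB : connected_set B := ball_connected (t := i1).
Let rB : r \in B := source_burning r _ i1.

Local Notation J := (last_round r f i1).
Local Notation arr := (arrival r f i1).
Local Notation gapm := (gap r f i1).
Local Notation ear_size := (ear_size r i1).
Local Notation spine := (spine r i1).
Local Notation openings := (opening r i1 (arrivals f J)).

Definition placed := placements s J.

Lemma i1J : i1 <= J. Proof. exact: first_le_last f_i1 quiet. Qed.

Lemma burning_i1 : burning r s i1 = B.
Proof.
apply: burning_quiet => i it; have [h _] := legal_s i.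
by apply/eqP; rewrite -cards_eq0 -leqn0 -(quiet it).
Qed.

Definition lost := saved r s :\: saved r S.

(** A vertex covered by no firefighter has only dominators outside [B] behind which no firefighter
    stands, so [dom_delay] applies to it. *)
Definition covered p : {set G} :=
  [set v | [exists z, [&& z \notin B, p \in dom r z & v \in dom r z]]].

Definition sheltered := \bigcup_(p in protected s J) covered p.

Lemma lost_props v : v \in lost ->
  [/\ v \in ball r J, v \notin burning r s J & v \notin B].
Proof.
rewrite in_setD (saved_last r f_i1) in_setC negbK => /andP[vS /savedP vs].
split=> //; first exact: (subsetP (burning_ball _ _ _)) vS.
by rewrite -burning_i1.
Qed.

(** By [dom_chain] the dominated sets containing [p] are nested, so their union is the largest of
    them. *)
Lemma card_covered p : #|covered p| <= tau.
Proof.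
have [z0 /andP[zB pz] | none] := pickP [pred z | (z \notin B) && (p \in dom r z)];
    last first.
  rewrite (_ : covered p = set0) ?cards0 //; apply/setP=> v; rewrite !inE.
  apply/negbTE/existsP=> -[z /and3P[zB pz _]].
  by have := none z; rewrite /= zB pz.
pose Q := [pred z | (z \notin B) && (p \in dom r z)].
have Qz0 : Q z0 by rewrite /= zB.
case: (arg_maxnP (fun z => #|dom r z|) Qz0) => z1 /andP[z1B pz1] max.
apply: leq_trans (dom_le z1B); apply: subset_leq_card; apply/subsetP=> v.
rewrite inE => /existsP[z /and3P[zB' pz' vz]].
have nr y : y \notin B -> y != r by move=> yB; apply: contraNneq yB => ->.
case: (dom_chain (nr _ zB') (nr _ z1B) pz' pz1) => [h|h].
  have : dom r z1 \subset dom r z by apply: dom_sub.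
  have : #|dom r z| <= #|dom r z1| by apply: max; rewrite /= zB'.
  by move=> c sub; move: vz; rewrite -(eqP (_ : dom r z1 == dom r z)) // eqEcard sub.
exact: (subsetP (dom_sub h)).
Qed.

Lemma not_sheltered v z : v \notin sheltered -> z \notin B -> v \in dom r z ->
  forall p, p \in dom r z -> p \notin protected s J.
Proof.
move=> vu zB vz p pz; apply: contra vu => pJ; apply/bigcupP; exists p => //.
by rewrite inE; apply/existsP; exists z; apply/and3P.
Qed.

Lemma source_neq z : z \notin B -> z != r.
Proof. by move=> zB; apply: contraNneq zB => ->. Qed.

Lemma on_time_burns v z t0 : v \notin sheltered -> z \notin B -> v \in dom r z ->
  (forall t, z \in ball r t -> t0 <= t) -> z \in burning r s t0 ->
  v \in ball r J -> v \in burning r s J.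
Proof.
move=> vu zB vz zt0 zb vJ; rewrite -[J]addn0.
apply: (@dom_delay _ _ _ z t0 0 J) => //; rewrite ?addn0 //.
- exact: source_neq.
- exact: not_sheltered vz.
Qed.

(** If [v] is not sheltered, [z] is unprotected and burns in the very next round, as early as
    possible; then [v] burns on time as well. *)
Lemma gate_not_lost v x z : x \in B -> z \notin B -> adj x z -> v \in dom r z ->
  v \in lost -> v \in sheltered.
Proof.
move=> xB zB xz vz vl; have [vJ vnb vB] := lost_props vl.
apply/negPn/negP=> vu; have iJ : i1 < J.
  by rewrite ltn_neqAle i1J andbT; apply: contraNneq vB => e; rewrite /B e.
case/negP: vnb; apply: (@on_time_burns v z i1.+1) => //.
  by move=> t zt; rewrite ltnNge; apply: contra zB => ti; apply: ball_le zt.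
apply/burningSP; right; split; last by exists x => //; rewrite burning_i1.
have zz : z \in dom r z.
  apply: dom_refl; [exact: source_neq|].
  by apply: connect_trans (ball_reachable xB) (connect1 xz).
apply: contra (not_sheltered vu zB vz zz).
exact: (subsetP (protected_mono _ _)).
Qed.

Definition on_spine c : pred G :=
  fun p => [exists j : 'I_#|G|.+1, (0 < j <= ear_size c) && (p == spine c false j)].

Lemma ear_size_le c : 0 < ear_size c -> ear_size c <= #|G|.
Proof.
move=> l0; have eu := spine_ear false l0.
have us : uniq [seq spine c false j | j <- iota 1 (ear_size c)].
  rewrite map_inj_in_uniq ?iota_uniq // => i j; rewrite !mem_iota => hi hj.
  by apply: (ear_inj eu); lia.
rewrite -(size_iota 1 (ear_size c)) -(size_map (spine c false)) -(card_uniqP us).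
exact: max_card.
Qed.

Lemma on_spineP c b p :
  reflect (exists2 j, 0 < j <= ear_size c & p = spine c b j) (on_spine c p).
Proof.
have fl : reflect (exists2 j, 0 < j <= ear_size c & p = spine c false j) (on_spine c p).
  apply: (iffP existsP) => [[j /andP[jl /eqP->]]|[j jl ->]]; first by exists j.
  have jn : j < #|G|.+1 by have := @ear_size_le c; lia.
  by exists (Ordinal jn); rewrite /= jl eqxx.
apply: (iffP fl) => -[j jl ->]; case: b; try (by exists j);
  exists ((ear_size c).+1 - j); try lia; rewrite spine_rev //; lia.
Qed.

(* Number of the first firefighter that the offline strategy places on the
   spine of [c]; it is at least [size placed] if there is none. *)
Definition first_on c := find (on_spine c) placed.

Definition firefighter c := nth r placed (first_on c).

Lemma first_on_le c p t : t <= J -> on_spine c p -> p \in protected s t ->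
  first_on c <= index p placed < size (placements s t).
Proof.
move=> tJ pc pt; rewrite index_placements // andbT leqNgt; apply/negP=> lt.
have pp : p \in placed.
  by rewrite mem_placements; apply: (subsetP (protected_mono _ tJ)).
by have := before_find r lt; rewrite nth_index ?pc.
Qed.

Lemma arrival_placed x t : t <= J -> x < size (placements s t) -> arr x < t.
Proof.
move=> tJ xt; rewrite /arrival arrival_lt //.
exact: leq_trans xt (size_placements t legal_s).
Qed.

Lemma i1_arrival x : i1 <= arr x.
Proof. exact: arrival_ge f_i1 quiet x. Qed.

Section Spine.
Variables (c : G) (b : bool).
Let l := ear_size c.
Let u := spine c b.
Hypothesis l0 : 0 < ear_size c.

Let eu : ear B u l := spine_ear b l0.
Let eu' : ear B (spine c (~~ b)) l := spine_ear (~~ b) l0.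

Lemma spread_back (s' : nat -> {set G}) T i : 0 < i <= l -> i <= T ->
  burning r s' i1 = B -> (forall p, on_spine c p -> p \notin protected s' (i1 + T)) ->
  u i \in burning r s' (i1 + i).
Proof.
move=> il iT bB np; have := @ear_spread _ r i1 s' _ l 0 T (l.+1 - i) eu' bB.
rewrite (_ : l.+1 - (l.+1 - i) = i); last lia.
rewrite spine_rev ?negbK; last by rewrite -/l; lia.
apply; try lia; move=> k kl; apply: np.
by apply/(@on_spineP _ (~~ b)); exists k.
Qed.

Lemma spine_ball i : 0 < i <= l -> u i \in ball r (i1 + i).
Proof.
move=> il; apply: (@spread_back _ i) => //.
by move=> p _; rewrite protected0 inE.
Qed.

(** On a spine free of offline firefighters, the fire from the nearer end [u l.+1] reaches [u i] at
    the earliest possible time, and an unsheltered [v] behind it burns on time. *)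
Lemma spine_not_lost v i : v \in lost -> v \notin sheltered -> 0 < i <= l ->
  v \in dom r (u i) -> l.+1 - i <= i -> first_on c < size placed.
Proof.
move=> vl vu il vi li; have [vJ vnb vB] := lost_props vl.
rewrite -has_find; apply/negPn/negP=> /hasPn nof; case/negP: vnb.
have uB := ear_out eu il.
have uJ : u i \in ball r J by apply: dom_ball vi vJ; apply: source_neq.
have := ear_time cactusG eu il uJ => h.
apply: (@on_time_burns v (u i) (i1 + (l.+1 - i))) => //.
  by move=> t /(ear_time cactusG eu il); clear - li; lia.
apply: (ear_spread eu burning_i1 (q := 0) (T := J - i1)); try (clear - il li h; lia).
move=> k kl; rewrite subnKC ?i1J //; apply/negP=> kp.
have := nof (u k); rewrite mem_placements => /(_ kp) /negP[].
by apply/(@on_spineP _ b); exists k.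
Qed.

Hypothesis xJ : first_on c < size placed.

Let e := firefighter c.

Lemma firefighter_on : on_spine c e.
Proof. by apply: nth_find; rewrite has_find. Qed.

Lemma firefighter_protected : e \in protected s J.
Proof. exact: nth_placements xJ. Qed.

(** Until [e] is placed the spine is free of firefighters, so [u q] would burn within [i1 + q]
    rounds. The arrival with the same number is no later than the placement of [e]. *)
Lemma firefighter_early q : 0 < q <= l -> u q = e -> arr (first_on c) < i1 + q.
Proof.
move=> ql uq; have /protectedP[t tJ et] := firefighter_protected.
have et1 : e \in protected s t.+1 by apply/protectedP; exists t.
have [_ dis] := legal_s t.
have := disjointFr dis et; rewrite in_setU => /norP[enb enp].
have xt : arr (first_on c) < t.+1.
  apply: arrival_placed => //; have := first_on_le tJ firefighter_on et1; lia.
apply: leq_ltn_trans (_ : t < _) => //.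
rewrite ltnNge; apply/negP=> qt; case/negP: enb; rewrite -uq.
apply: (burning_le qt); apply: (@spread_back s (t - i1)) => //.
- by lia.
- exact: burning_i1.
rewrite subnKC; last lia.
move=> p pc; apply/negP=> pt; case/negP: enp.
have /andP[xp pp] := first_on_le (ltnW tJ) pc pt.
apply: nth_placements; first exact: ltnW.
exact: leq_ltn_trans pp.
Qed.

(** Any further spine firefighter has a larger number, hence is placed no earlier than the next
    arrival. *)
Lemma no_other p : on_spine c p -> p \in protected s (arr (first_on c).+1) -> p = e.
Proof.
move=> pc pt; have [//|ne] := eqVneq p e.
have tJ : arr (first_on c).+1 <= J by apply: arrival_le.
have /andP[xp pp] := first_on_le tJ pc pt.
have := arrival_placed tJ pp.
suff : arr (first_on c).+1 <= arr (index p placed) by lia.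
apply: arrival_mono; rewrite ltn_neqAle xp andbT; apply: contraNneq ne => xe.
rewrite /e /firefighter xe nth_index // mem_placements.
exact: (subsetP (protected_mono _ tJ)).
Qed.

(* If the last conjunct failed, the fire, although it comes from the far end of
   the ear, would have had the time to burn the whole dominated set. *)
Lemma behind_firefighter v q i M : v \in lost -> v \notin sheltered ->
  0 < q < i -> i <= l -> u q = e -> v \in dom r (u i) ->
  M.*2 <= first_on c ->
  [/\ arr M.*2 - i1 < i, i + (arr M.*2 - i1) <= l &
      arr (first_on c).+1 - i1 < l - i + #|dom r (u i)|].
Proof.
move=> vl vu qi il uq vi Mx; have [vJ vnb vB] := lost_props vl.
have ql : 0 < q <= l by lia.
have il' : 0 < i <= l by lia.
have eq := firefighter_early ql uq.
have m1 : arr M.*2 <= arr (first_on c) by apply: arrival_mono.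
have m2 : arr (first_on c) <= arr (first_on c).+1 by apply: arrival_mono.
have tJ : arr (first_on c).+1 <= J by apply: arrival_le.
have uB := ear_out eu il'.
have d0 : 0 < #|dom r (u i)|.
  by apply/card_gt0P; exists v.
have ge x := i1_arrival x.
have g1 := ge M.*2; have g2 := ge (first_on c); have g3 := ge (first_on c).+1.
have late t : u i \in ball r t -> i1 + minn i (l.+1 - i) <= t.
  exact: (ear_time cactusG eu il').
have [lT|Tl] := leqP (l.+1 - i) (arr (first_on c).+1 - i1);
    last by split; clear - qi il eq m1 m2 g1 g2 g3 d0 Tl; lia.
have ub : u i \in burning r s (i1 + (l.+1 - i)).
  apply: (ear_spread eu burning_i1 (q := q) (T := arr (first_on c).+1 - i1));
      try (clear - qi il lT; lia).
  move=> k kl; rewrite subnKC //; apply/negP=> kp.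
  have uk : on_spine c (u k) by apply/(@on_spineP _ b);
      exists k => //; clear - kl qi; lia.
  have kq : u k = u q by rewrite (no_other uk kp).
  by have := ear_inj eu _ _ kq; clear - kl qi il; lia.
(* If the far end is the nearer one, [u i] burns without delay; otherwise the delay is
   [l + 1 - 2 i]. *)
have [li|il2] := leqP (l.+1 - i) i.
  case/negP: vnb; apply: on_time_burns vi _ ub vJ => // t /late; lia.
have [tooearly|late1] := leqP (l.+1 - i + #|dom r (u i)|.-1) (J - i1);
    last by split; clear - qi il eq m1 m2 g1 g2 g3 d0 il2 tJ late1; lia.
(* The unhindered fire has [u i] by time [i1 + i] and its dominated set within [|dom r (u i)| - 1]
   more rounds; the delay is added to that. *)
case/negP: vnb; apply: (@burning_le _ _ _
    (i1 + i + #|dom r (u i)|.-1 + (l.+1 - i - i))).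
  by clear - tooearly il2 g3 tJ d0; lia.
apply: (@dom_delay _ _ _ (u i) (i1 + i) _ J) => //.
- exact: source_neq.
- by move=> t /late; clear - il2; lia.
- by rewrite -addnA (_ : i + _ = l.+1 - i) //; clear - il2 il; lia.
- exact: not_sheltered vi.
- by apply: dom_depth => //; [exact: source_neq | exact: spine_ball].
- by clear - tooearly il2 g3 tJ d0; lia.
Qed.

Definition behind : {set G} := [set v in lost | (v \notin sheltered) &&
  [exists i : 'I_#|G|.+1, [exists q : 'I_#|G|.+1,
    [&& 0 < q < i, i <= l, u q == e & v \in dom r (u i)]]]].

(* A lost vertex of the spine is itself a candidate for the [M]-th opening, so
   that the maximality of the score of that opening confines its index to a
   window of length [2 * gap M]. *)
Lemma card_behind M : M.*2 <= first_on c -> c \notin used r i1 (arrivals f J) M ->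
  #|behind| <= 2 * tau * gapm M.
Proof.
move=> Mx cM.
have MJ : M.*2 < size (arrivals f J).
  apply: leq_ltn_trans Mx (leq_trans xJ _); exact: size_placements legal_s.
have T0 := arrival_nth0 MJ.
pose T' := arr M.*2.+1 - i1; pose D := gapm M.
pose F d := let i := l.+1 + d - (T' + D) in
  if 0 < i <= l then dom r (u i) else set0.
have Ftau d : #|F d| <= tau.
  rewrite /F; case: ifP => il; last by rewrite cards0.
  exact: dom_le (ear_out eu il).
suff sub : behind \subset \bigcup_(d < 2 * D) F d.
  apply: leq_trans (subset_leq_card sub) _.
  apply: leq_trans (card_bigcup_le _ _) _.
  apply: (@leq_trans (\sum_(d < 2 * D) tau)); first by apply: leq_sum => d _.
  by rewrite sum_nat_const card_ord mulnAC.
apply/subsetP=> v; rewrite inE => /and3P[vl vu /existsP[i /existsP[q]]].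
case/and4P=> qi il /eqP uq vi.
have [Ti iT T2] := behind_firefighter vl vu qi il uq vi Mx.
have ek : eligible r i1 (arr M.*2 - i1) (used r i1 (arrivals f J) M) (c, b, i).
  by apply/and3P.
have [k ok] := best_exists ek; rewrite -T0 -/(opening _ _ _ _) in ok.
have := ok; rewrite /opening T0 => /best_some[_ /(_ _ ek)].
rewrite /score /= /target /= -/u -/l => sc.
have TT : T' <= arr (first_on c).+1 - i1.
  by apply: leq_sub2r; apply: arrival_mono; lia.
have d0 : 0 < #|dom r (u i)| by apply/card_gt0P; exists v.
have DE : D = score r i1 k - T' by rewrite /D /gap ok.
have sc' : (l.+1 - i) + 2 * #|dom r (u i)| <= score r i1 k by [].
(* Since [T' < l - i + |dom r (u i)|], the score exceeds [T'] by more than [|dom r (u i)|]. Hence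
   [i + T' < l + |dom r (u i)| < l + 1 + D]. *)
have dD : i + T' + D - l.+1 < 2 * D by lia.
apply/bigcupP; exists (Ordinal dD) => //; rewrite /F /=.
have ei : l.+1 + (i + T' + D - l.+1) - (T' + D) = i by lia.
have il' : 0 < i <= l by lia.
by rewrite ei il'.
Qed.

End Spine.

Definition charged c := first_on c < size placed.

Definition pairs := uphalf (size (arrivals f J)).

(* The ear [c] is charged to the pair that contains the number of the first
   offline firefighter on it, or to the earlier pair that opened it. *)
Definition budget c := \sum_(m < pairs)
  (((first_on c)./2 == m) + (if openings m is Some k then k.1.1 == c else false)) * gapm m.

Lemma size_placed : size placed <= size (arrivals f J).
Proof. exact: size_placements legal_s. Qed.

Lemma charged_pair c : charged c -> (first_on c)./2 < pairs.
Proof. by rewrite /charged /pairs => h; have := size_placed; lia. Qed.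

Lemma budget_ge c m (mp : m < pairs) :
  (first_on c)./2 = m \/ (exists2 k, openings m = Some k & k.1.1 = c) ->
  gapm m <= budget c.
Proof.
move=> h; rewrite /budget (bigD1 (Ordinal mp)) //= (leq_trans _ (leq_addr _ _)) //.
apply: leq_pmull; case: h => [->|[k -> ->]]; first by rewrite eqxx.
by rewrite eqxx addn1.
Qed.

Lemma charge c : charged c -> exists M, [/\ M.*2 <= first_on c,
  c \notin used r i1 (arrivals f J) M & gapm M <= budget c].
Proof.
move=> ch; have cp := charged_pair ch.
have [/usedP[m [k [mx ok kc]]]|nu]
    := boolP (c \in used r i1 (arrivals f J) (first_on c)./2).
  exists m; split; first lia.
    by move: ok; rewrite /opening => /best_some[/and3P[_ _]]; rewrite kc.
  by apply: budget_ge; [lia|right; exists k].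
exists (first_on c)./2; split=> //; first lia.
by apply: budget_ge => //; left.
Qed.

Lemma first_on_inj c c' : charged c -> 0 < ear_size c -> charged c' ->
  0 < ear_size c' -> first_on c = first_on c' -> c = c'.
Proof.
move=> ch l0 ch' l0' e.
have /(@on_spineP _ false)[j jl ej] := firefighter_on ch.
have /(@on_spineP _ false)[j' jl' ej'] := firefighter_on ch'.
have := spine_region false jl; have := spine_region false jl'.
rewrite -ej -ej' !inE => /andP[_ /eqP rc'] /andP[_ /eqP rc].
by rewrite -rc -rc' /firefighter e.
Qed.

Lemma charged_ear c : charged c -> 0 < ear_size c.
Proof. by move=> /firefighter_on/(@on_spineP _ false)[j jl _]; lia. Qed.

(** A pair is charged by at most two ears through the number of their first firefighter, which
    parity tells apart, and by at most one ear that it opened. *)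
Lemma sum_budget : \sum_(c | charged c) budget c <= 3 * \sum_(m < pairs) gapm m.
Proof.
rewrite exchange_big /= big_distrr /=; apply: leq_sum => m _.
rewrite -big_distrl /= leq_mul2r; apply/orP; right.
have cnt (Q : pred G) :
    \sum_(c | charged c) nat_of_bool (Q c) = #|[set c | charged c && Q c]|.
  by rewrite -sum1dep_card big_mkcondr; apply: eq_bigr => c _; case: (Q c).
rewrite big_split /= -[3]/(2 + 1); apply: leq_add.
  rewrite cnt.
  set A := [set _ | _].
  rewrite -(card_in_imset (f := fun c => odd (first_on c)) (D := A)).
    by rewrite (leq_trans (max_card _)) // card_bool.
  move=> c c'; rewrite !inE => /andP[ch /eqP em] /andP[ch' /eqP em'] eo.
  apply: first_on_inj => //; try exact: charged_ear.
  by rewrite -[first_on c]odd_double_half -[RHS]odd_double_half eo em em'.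
case: (openings m) => [k|].
  rewrite cnt; apply: (@leq_trans #|[set k.1.1]|); last by rewrite cards1.
  apply: subset_leq_card; apply/subsetP=> c.
  by rewrite !inE eq_sym => /andP[].
by rewrite big1.
Qed.

(** Gates lose only sheltered vertices, so an unsheltered one hangs on an ear. Its position differs
    from that of the firefighter there, which thus precedes it in one of the two directions. *)
Lemma lost_sub : lost \subset
  sheltered :|: \bigcup_(c | charged c) (behind c false :|: behind c true).
Proof.
apply/subsetP=> v vl; rewrite in_setU; have [//|vu] := boolP (v \in sheltered).
have [vJ vnb vB] := lost_props vl.
have [[u [l [eu vu1]]]|[x [z [xB zB xz vz]]]] := ear_or_gate rB vB (ball_reachable vJ);
    last by rewrite (gate_not_lost xB zB xz vz vl) in vu.
set c := fingraph.root (outer r i1) v.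
have l0 : 0 < ear_size c.
  apply: (@exists_ear _ _ _ _ (u, l)); split=> //=.
  by apply/esym/(fingraph.rootP (@outer_sym _ r i1)).
have eu1 : connect (outer r i1) (spine c false 1) v.
  rewrite outer_sym; apply/(fingraph.rootP (@outer_sym _ r i1)).
  have l1 : 0 < 1 <= ear_size c by [].
  by have := spine_region false l1; rewrite inE => /andP[_ /eqP->].
have [i il vi] := ear_region cactusG cB rB (spine_ear false l0) eu1.
have ch : charged c.
  (* The direction is chosen so that [u l.+1] is the end nearer to [v]. *)
  have [li|li] := leqP ((ear_size c).+1 - i) i.
    exact: (spine_not_lost l0 vl vu il vi li).
  apply: (@spine_not_lost c true l0 v ((ear_size c).+1 - i) vl vu);
      try (clear - il li; lia).
  by rewrite spine_rev //; clear - il; lia.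
apply/bigcupP; exists c => //.
have /(@on_spineP _ false)[q ql eq] := firefighter_on ch.
have ln := ear_size_le l0.
have mem b a d : 0 < a < d -> d <= ear_size c -> spine c b a = firefighter c ->
    v \in dom r (spine c b d) -> v \in behind c b.
  move=> ad dl ea vd; rewrite inE vl vu /=.
  have an : a < #|G|.+1 by clear - ad dl ln; lia.
  have dn : d < #|G|.+1 by clear - dl ln; lia.
  apply/existsP; exists (Ordinal dn); apply/existsP; exists (Ordinal an).
  by rewrite /= ad dl ea eqxx.
rewrite in_setU; case: (ltngtP q i) => qi.
- apply/orP; left; apply: (mem false q i _ _ (esym eq) vi); clear - ql qi il; lia.
- apply/orP; right; apply: (mem true ((ear_size c).+1 - q) ((ear_size c).+1 - i));
      try (clear - ql qi il; lia).
    by rewrite spine_rev //; clear - ql qi il; lia.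
  by rewrite spine_rev //; clear - ql qi il; lia.
- have eu0 := spine_ear false l0.
  have := not_sheltered vu (ear_out eu0 il) vi.
  move/(_ (firefighter c)); rewrite firefighter_protected // eq qi => h.
  have : false by apply: h; apply: (ear_mem_dom cB rB eu0).
  by [].
Qed.

(* Sheltered vertices contribute [tau], and the remaining ones
   [4 tau * 3 * 3 = 36 tau], to the constant. *)
Theorem offline_bound : #|saved r s| <= (37 * tau + 1) * #|saved r S|.
Proof.
have cl : #|lost| <= 37 * tau * #|saved r S|.
  apply: leq_trans (subset_leq_card lost_sub) _.
  apply: leq_trans (leq_card_setU _ _).1 _.
  have c1 : #|sheltered| <= tau * #|saved r S|.
    apply: leq_trans (card_bigcup_le _ _) _.
    apply: (@leq_trans (\sum_(p in protected s J) tau)).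
      by apply: leq_sum => p _; apply: card_covered.
    rewrite sum_nat_const mulnC leq_mul2l; apply/orP; right.
    apply: leq_trans (firefighters_le_saved r f_i1).
    apply: leq_trans size_placed; rewrite /placed.
    apply: leq_trans (card_size _); apply: subset_leq_card.
    by apply/subsetP=> v; rewrite mem_placements.
  have c2 : #|\bigcup_(c | charged c) (behind c false :|: behind c true)| <=
      4 * tau * \sum_(c | charged c) budget c.
    apply: leq_trans (card_bigcup_le _ _) _; rewrite big_distrr /=.
    apply: leq_sum => c ch; have [M [Mx cM gM]] := charge ch.
    apply: leq_trans (leq_card_setU _ _).1 _.
    have h b := card_behind b (charged_ear ch) ch Mx cM.
    have := leq_mul (leqnn (2 * tau)) gM.
    by have := h false; have := h true; lia.
  have p2 : pairs.*2 <= (size (arrivals f J)).+1 by rewrite /pairs; lia.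
  have g := sum_gap_le cactusG f_i1 quiet no_gate p2.
  have := leq_mul (leqnn (4 * tau)) sum_budget.
  have := leq_mul (leqnn (4 * tau * 3)) g.
  rewrite -/S; nia.
have : #|saved r s| <= #|lost| + #|saved r S|.
  apply: leq_trans (leq_card_setU _ _).1; apply: subset_leq_card.
  by apply/subsetP=> v vs; rewrite in_setU in_setD vs andbT -/S;
      case: (v \in saved r S).
by rewrite mulnDl mul1n; lia.
Qed.

End Offline.

(** * The optimum and the integer form of the upper bound *)

Section Optimum.
Variables (G : sgraph) (r : G) (f : nat -> nat).

Lemma opt_leP m : reflect (forall s, legal r f s -> #|saved r s| <= m) (opt r f <= m).
Proof.
apply: (iffP (bigmax_leqP _ _ _)) => [h s leg|
    h k /boolp.asboolP[s [leg <-]]]; last exact: h.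
have kn : #|saved r s| < #|G|.+1 by rewrite ltnS max_card.
by apply: (h (Ordinal kn)); apply/boolp.asboolP; exists s.
Qed.

Lemma saved_le_opt s : legal r f s -> #|saved r s| <= opt r f.
Proof. by move=> leg; apply: (elimT (opt_leP _) (leqnn _)). Qed.

Lemma dom_saved s z j : z != r -> legal r f s -> z \in protected s j ->
  dom r z \subset saved r s.
Proof.
move=> zr leg zp; apply/subsetP=> v vz; apply/savedP=> t.
elim: t v vz => [|t IH] v vz.
  by rewrite /= in_set1; apply: contraTneq vz => ->; apply: dom_source.
apply/burningSP=> -[vt|[vp [w wb wv]]]; first by have := IH v vz; rewrite vt.
have vnz : v != z.
  apply: contraTneq wb => ev; have vs := legal_protected t.+1 leg zp.
  apply/negP=> wb; case/negP: vs; rewrite -ev; apply/burningSP; right.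
  by split=> //; exists w.
have vw : adj v w by rewrite adj_sym.
by have := IH w (dom_step zr vz vnz vw); rewrite wb.
Qed.

Lemma pairing_bound : cactus G ->
  (exists2 tau, 9 * tau ^ 2 <= #|G| &
     opt r f <= (37 * tau + 1) * #|saved r (strategy r f)|) \/
  #|G| <= 9 * #|saved r (strategy r f)| ^ 2.
Proof.
move=> cG; have leg := strategy_legal r f.
case: (boolp.pselect (exists t, 0 < f t)) => [ex|none]; last first.
  (* Without firefighters every legal strategy is empty, so both values agree. *)
  left; exists 0 => //; rewrite muln0 mul1n; apply/opt_leP => s ls.
  have e0 s' : legal r f s' -> s' =1 fun=> set0.
    move=> ls' t; have [h _] := ls' t; apply/eqP; rewrite -cards_eq0 -leqn0.
    apply: leq_trans h _; rewrite leqNgt; apply/negP=> ft; apply: none.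
    by exists t.
  by rewrite (saved_ext r (e0 _ ls)) (saved_ext r (e0 _ leg)).
have [i1 f_i1 min] := ex_minnP ex.
have quiet t : t < i1 -> f t = 0.
  by move=> ti; apply/eqP; rewrite -leqn0 leqNgt; apply/negP=> /min; lia.
have [z gz|no_gate] := pickP (gate r i1).
  right; have hd := head_arrivals r f_i1 quiet (leqnn i1).
  have dz : exists2 z', gate r i1 z' & z' \in desired r f i1.
    rewrite /desired hd eqxx f_i1; case: pickP => [z' gz'|none].
      by exists z'; rewrite ?inE.
    by have := none z; rewrite gz.
  have [z' /andP[zB zn] zd] := dz; apply: leq_trans zn _.
  have zr : z' != r by apply: contraNneq zB => ->; apply: source_burning.
  have zp : z' \in protected (strategy r f) i1.+1.
    apply: strategy_requested zd _; apply: contra zB.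
    exact: (subsetP (burning_ball _ _ _)).
  rewrite leq_mul2l leq_exp2r //=; apply: subset_leq_card; exact: dom_saved zp.
(* In the absence of gates every dominated set outside the ball has size below [sqrt n / 3]. *)
left; pose tau := \max_(z | z \notin ball r i1) #|dom r z|; exists tau.
  rewrite /tau; elim/big_ind: _ => [//|x y hx hy|z zB].
    by rewrite /maxn; case: ifP.
  by have := no_gate z; rewrite /gate zB /= => /negbT; rewrite -ltnNge => /ltnW.
apply/opt_leP => s ls; apply: (offline_bound cG f_i1 quiet _ _ ls) => [z|z zB].
  by rewrite no_gate.
by apply: (leq_bigmax_cond (F := fun z => #|dom r z|)).
Qed.

Lemma connect_burns s (P : {set G}) v : (forall t, protected s t \subset P) ->
  connect (inside (~: P)) r v -> exists t, v \in burning r s t.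
Proof.
move=> sP; move: v; apply: connect_inside_ind.
  by exists 0; rewrite /= in_set1.
move=> y z [t yt] _; rewrite in_setC => zP yz; exists t.+1.
apply/burningSP; right; split; last by exists y.
by apply: contra zP; apply: (subsetP (sP _)).
Qed.

End Optimum.

(** * The lower bound *)

Lemma next_neq_prev (T : eqType) (c : seq T) x :
  uniq c -> 2 < size c -> x \in c -> next c x != prev c x.
Proof.
move=> uc sc xc; have [i p ec] := rot_to xc.
rewrite -(next_rot i uc) -(prev_rot i uc) next_nth prev_nth ec mem_head.
have /andP[xp up] : uniq (x :: p) by rewrite -ec rot_uniq.
have sp : 2 < size (x :: p) by rewrite -ec size_rot.
rewrite (memNindex xp) [index x _]/= eqxx.
case: p up sp {ec xp} => [//|y p] up sp.
by rewrite [nth x _ (size _)]/= nth_uniq //; case: p sp {up}.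
Qed.

Section Gadget.
Variables m k : nat.

(* A cycle of length [m + 3] and a star with [k + 1] vertices, whose centre is
   joined to the source on the cycle. *)
Definition gadget_adj : rel ('I_m.+3 + 'I_k.+1) := fun x y =>
  match x, y with
  | inl i, inl j => (j == ordS i) || (i == ordS j)
  | inl i, inr a | inr a, inl i => (i == ord0) && (a == ord0)
  | inr a, inr b => (a == ord0) (+) (b == ord0)
  end.

Lemma gadget_sym : symmetric gadget_adj.
Proof. by move=> [i|a] [j|b] //=; [rewrite orbC|rewrite addbC]. Qed.

Lemma gadget_irr : irreflexive gadget_adj.
Proof.
move=> [i|a] /=; last by rewrite addbb.
rewrite orbb; apply/eqP=> /(congr1 val) /=; have := ltn_ord i.
by rewrite leq_eqVlt => /predU1P[[->]|h]; rewrite ?modnn // modn_small //; lia.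
Qed.

Definition gadget : sgraph := SGraph gadget_sym gadget_irr.

Definition gadget_source : gadget := inl ord0.

Lemma card_gadget : #|gadget| = m + k + 4.
Proof. by rewrite card_sum !card_ord; lia. Qed.

Lemma gadget_cycle_in (c : seq gadget) x : simple_cycle c -> x \in c ->
  exists y z, [/\ y != z, y \in c & z \in c] /\
    [/\ adj x y, adj x z, next c x = y & next c z = x].
Proof.
case/and3P=> sc uc cc xc; exists (next c x), (prev c x); split; split=> //.
- exact: next_neq_prev.
- by rewrite mem_next.
- by rewrite mem_prev.
- exact: next_cycle.
- by rewrite adj_sym; apply: prev_cycle.
- exact: next_prev.
Qed.

(** A leaf has one neighbour only; once leaves are excluded, the centre has just the source left as
    a neighbour on the cycle. *)
Lemma gadget_cycle_star (c : seq gadget) a : simple_cycle c -> inr a \in c -> False.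
Proof.
move=> sc.
have leaf b : b != ord0 -> inr b \in c -> False.
  move=> b0 bc; have [y [z [[yz _ _] [ay az _ _]]]] := gadget_cycle_in sc bc.
  have only (w : gadget) : adj (inr b : gadget) w -> w = inr ord0.
    case: w => [j|d] /=; first by rewrite (negbTE b0) andbF.
    by rewrite (negbTE b0) => /eqP->.
  by rewrite (only _ ay) (only _ az) eqxx in yz.
have [->|] := eqVneq a ord0; last exact: leaf.
move=> ac; have [y [z [[yz yc zc] [ay az _ _]]]] := gadget_cycle_in sc ac.
have only (w : gadget) : w \in c -> adj (inr ord0 : gadget) w -> w = inl ord0.
  case: w => [j _|d dc] /=; first by rewrite eqxx andbT => /eqP->.
  by move=> /leaf h; case: (h dc).
by rewrite (only _ yc ay) (only _ zc az) eqxx in yz.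
Qed.

Lemma gadget_next (c : seq gadget) i : simple_cycle c -> (inl i : gadget) \in c ->
  (inl (ordS i) : gadget) \in c /\
  (next c (inl i : gadget) = inl (ordS i) \/ next c (inl (ordS i) : gadget) = inl i).
Proof.
move=> sc ic; have [y [z [[yz yc zc] [ay az ny nz]]]] := gadget_cycle_in sc ic.
have only (w : gadget) : w \in c -> adj (inl i : gadget) w ->
    w = inl (ordS i) \/ w = inl (ord_pred i).
  case: w => [j _|d dc _] /=; last by case: (gadget_cycle_star sc dc).
  by case/orP=> /eqP->; [left|right; rewrite ordSK].
case: (only _ yc ay) => ey; first by rewrite ny -ey; split=> //; left.
case: (only _ zc az) => ez; last by rewrite ey ez eqxx in yz.
by rewrite -ez; split=> //; right.
Qed.

Lemma val_ordS_iter (i : 'I_m.+3) d : val (iter d (@ordS _) i) = (i + d) %% m.+3.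
Proof.
elim: d => [|d IH]; first by rewrite addn0 modn_small.
by rewrite iterS /= [X in X.+1 %% _]IH addnS -addn1 modnDml addn1.
Qed.

Lemma gadget_all (c : seq gadget) i : simple_cycle c -> (inl i : gadget) \in c.
Proof.
move=> sc.
have [[j|a] jc] : exists x, x \in c.
    by case/and3P: sc; case: c => // x *; exists x; rewrite mem_head.
  have it d : (inl (iter d (@ordS _) j) : gadget) \in c.
    by elim: d => //= d IH; case: (gadget_next sc IH).
  rewrite (_ : i = iter (i + (m.+3 - j)) (@ordS _) j) //; apply: val_inj.
  rewrite val_ordS_iter addnCA subnKC; last exact: ltnW.
  by rewrite modnDr modn_small.
by case: (gadget_cycle_star sc jc).
Qed.

Lemma gadget_cycle_edges (c : seq gadget) : simple_cycle c -> cycle_edges c =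
  [set [set (inl i : gadget); inl (ordS i)] | i : 'I_m.+3].
Proof.
move=> sc; apply/setP=> e; apply/imsetP/imsetP=> -[].
  move=> [i|a] ic ->; last by case: (gadget_cycle_star sc ic).
  have [y [z [[yz yc zc] [ay az ny nz]]]] := gadget_cycle_in sc ic.
  rewrite ny; case: y ay yc {yz ny} => [j|a] ay yc;
      last by case: (gadget_cycle_star sc yc).
  by case/orP: ay => /eqP->; [exists i|exists j; rewrite // setUC].
move=> i _ ->; case: (gadget_next sc (gadget_all i sc)) => _ [ni|ni].
  by exists (inl i); rewrite ?gadget_all // ni.
by exists (inl (ordS i)); rewrite ?gadget_all // ni setUC.
Qed.

(** All simple cycles share one edge set, that of the big cycle. *)
Lemma gadget_cactus : cactus gadget.
Proof.
move=> x y c1 c2 _ s1 s2 _ _.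
by rewrite (gadget_cycle_edges s1) (gadget_cycle_edges s2).
Qed.

(* A protected vertex of the cycle blocks only one of the two directions. *)
Lemma gadget_connected (P : {set gadget}) i :
  (forall i j, inl i \in P -> inl j \in P -> i = j) ->
  gadget_source \notin P -> (inl i : gadget) \notin P ->
  connect (inside (~: P)) gadget_source (inl i).
Proof.
move=> P1 P0 Pi; pose u j : gadget := inl (inord j).
have ui : u i = inl i by rewrite /u inord_val.
have adju j : j < m.+2 -> adj (u j) (u j.+1).
  move=> jm; apply/orP; left; apply/eqP/val_inj.
  by rewrite /= !inordK ?modn_small //; lia.
have adj0 : adj gadget_source (u m.+2).
  apply/orP; right; apply/eqP/val_inj; by rewrite /= inordK // modnn.
have u0 : u 0 = gadget_source.
  by rewrite /u /gadget_source; congr inl; apply/val_inj; rewrite /= inordK.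
have step x y : connect (inside (~: P)) gadget_source x -> x \notin P -> y \notin P ->
    adj x y -> connect (inside (~: P)) gadget_source y.
  move=> cx xP yP xy; apply: (connect_trans cx); apply: connect1.
  by rewrite /inside !in_setC xP yP.
have [/existsP[p /andP[pi Pp]]|none]
    := boolP [exists p : 'I_m.+3, (p < i) && (u p \in P)].
  have out j : p < j -> j < m.+3 -> u j \notin P.
    move=> pj jm; apply/negP=> Pj; have := P1 _ _ Pp Pj.
    by move/(congr1 val); rewrite /= !inordK //; lia.
  have down d : d <= m.+2 - i -> connect (inside (~: P)) gadget_source (u (m.+2 - d)).
    have im := ltn_ord i; elim: d => [|d IH] dm.
      by rewrite subn0; apply: (step gadget_source) => //; apply: out; lia.
    apply: (step (u (m.+2 - d))); [apply: IH|apply: out|apply: out|]; try lia.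
    rewrite adj_sym (_ : m.+2 - d = (m.+2 - d.+1).+1); last lia.
    by apply: adju; lia.
  by have := down _ (leqnn _); rewrite subKn ?ui //; have := ltn_ord i; lia.
have out j : j <= i -> u j \notin P.
  rewrite leq_eqVlt => /predU1P[->|ji]; first by rewrite ui.
  have jm : j < m.+3 by have := ltn_ord i; lia.
  by apply: contra none => Pj; apply/existsP; exists (Ordinal jm); rewrite ji.
have up d : d <= i -> connect (inside (~: P)) gadget_source (u d).
  have im := ltn_ord i; elim: d => [|d IH] di; first by rewrite u0.
  apply: (step (u d)); [apply: IH|apply: out|apply: out|apply: adju]; lia.
by rewrite -ui; apply: up.
Qed.

Definition star : {set gadget} := [set inr a | a : 'I_k.+1].

Lemma star_inl i : (inl i : gadget) \in star = false.
Proof. by apply/negbTE/imsetP=> -[]. Qed.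

Lemma star_inr a : (inr a : gadget) \in star.
Proof. exact: imset_f. Qed.

Lemma card_star : #|star| = k.+1.
Proof. by rewrite card_imset ?card_ord // => a b []. Qed.

Lemma opt_star f : 0 < f 0 -> k.+1 <= opt gadget_source f.
Proof.
move=> f0; pose s t : {set gadget} := if t is 0 then [set inr ord0] else set0.
have leg : legal gadget_source f s.
  case=> [|t]; last by rewrite cards0 disjoint_sym disjoints_subset setC0 subsetT.
  by rewrite cards1; split=> //; rewrite disjoints1 !inE.
apply: leq_trans (saved_le_opt leg); rewrite -card_star.
apply: subset_leq_card; apply/subsetP=> v vs; apply/savedP=> t; move: vs.
apply: contraL => vb;
    suff h : forall w, w \in burning gadget_source s t -> w \notin star.
  exact: h.
elim: t {v vb} => [|t IH] v; first by rewrite /= in_set1 => /eqP->; rewrite star_inl.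
case/burningSP=> [/IH//|[vp [w /IH]]].
case: w => [i _|a]; last by rewrite star_inr.
case: v vp => [j _ _|a vp]; first by rewrite star_inl.
case/andP=> _ /eqP a0; case/negP: vp; apply/protectedP; exists 0 => //.
by rewrite a0 in_set1.
Qed.

Lemma val_ordS (i : 'I_m.+3) : val (ordS i) = if i == ord_max then 0 else i.+1.
Proof.
rewrite /= -val_eqE /=; case: eqP => [->|ni]; first by rewrite modnn.
by rewrite modn_small //; have := ltn_ord i; lia.
Qed.

(** Protect vertex [1], then vertex [m + 1], as the last vertex [m + 2] burns in the first round.
    They differ because [0 < m]. *)
Lemma opt_cycle f : 0 < m -> 0 < f 0 -> 0 < f 1 -> m.+1 <= opt gadget_source f.
Proof.
move=> m0 f0 f1; pose p (j : nat) : gadget := inl (inord j).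
pose s t : {set gadget} :=
  if t is t'.+1 then if t' is 0 then [set p m.+1] else set0 else [set p 1].
(* Invariant of the fire: on the cycle it stays on the source and the last vertex. *)
pose Z (w : gadget) := if w is inl i then (i == ord0) || (i == ord_max) else true.
have p1 t : p 1 \in protected s t.+1.
  by apply/protectedP; exists 0; rewrite ?in_set1.
have p2 t : p m.+1 \in protected s t.+2.
  by apply/protectedP; exists 1; rewrite ?in_set1.
have from0 t w : w \notin protected s t.+1 -> adj gadget_source w -> Z w.
  case: w => [j|//] jp /orP[] /eqP e; last first.
    move/(congr1 val): e; rewrite val_ordS /= /Z.
    by case: (j =P ord_max) => // _; rewrite orbT.
  case/negP: jp; suff -> : inl j = p 1 by [].
  congr inl; apply: val_inj; rewrite e val_ordS [RHS]/= inordK //.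
have inZ t w : w \in burning gadget_source s t.+1 -> Z w.
  elim: t w => [|t IH] w; case/burningSP.
  - by rewrite /= in_set1 => /eqP->.
  - by case=> wp [x]; rewrite /= in_set1 => /eqP->; apply: from0 wp.
  - exact: IH.
  case=> wp [x /IH]; case: x => [i|a]; last first.
    by case: w wp => // j _ _ /= /andP[->].
  case/orP=> /eqP->; first exact: from0 wp.
  case: w wp => [j|//] jp /orP[] /eqP e.
    by move/(congr1 val): e; rewrite val_ordS eqxx /Z -val_eqE => ->.
  case/negP: jp; suff -> : inl j = p m.+1 by [].
  congr inl; apply: val_inj; move/(congr1 val): e; rewrite val_ordS /=.
  by case: (j == ord_max) => // -[<-]; rewrite inordK.
have leg : legal gadget_source f s.
  case=> [|[|t]]; last by rewrite cards0 disjoint_sym disjoints_subset setC0 subsetT.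
    rewrite cards1; split=> //; rewrite disjoints1 !inE orbF.
    by apply/eqP=> -[/(congr1 val)]; rewrite /= inordK.
  rewrite cards1; split=> //; rewrite disjoints1 in_setU negb_or.
  apply/andP; split.
    by apply/negP=> /inZ; rewrite /Z /= => /orP[] /eqP/(congr1 val); rewrite /= inordK //; lia.
  rewrite /= set0U in_set1; apply/eqP=> -[/(congr1 val)].
  by rewrite /= !inordK // => -[e]; rewrite e in m0.
apply: leq_trans (saved_le_opt leg).
pose D : {set 'I_m.+3} := ~: [set ord0; ord_max].
have cD : #|D| = m.+1 by rewrite /D cardsCs setCK cards2 card_ord /= subn2.
rewrite -cD -(card_imset _ (_ : injective (inl : _ -> gadget))); last by move=> x y [].
apply: subset_leq_card; apply/subsetP=> _ /imsetP[i iD ->]; apply/savedP=> t.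
move: iD; apply: contraL => ib.
have /inZ : (inl i : gadget) \in burning gadget_source s t.+1.
  exact: burning_le (leqnSn t) ib.
by rewrite /D !inE negbK.
Qed.

(** The adversary sends a second firefighter exactly if the first one goes to the star. Then at most
    one can stand on the cycle, and [gadget_connected] burns the rest of it. *)
Lemma gadget_lower (A : decision_rule) : online_algorithm A -> 0 < m -> exists f,
  (k.+1 <= opt gadget_source f /\ alg_value A gadget_source f <= 1) \/
  (m.+1 <= opt gadget_source f /\ alg_value A gadget_source f <= k.+2).
Proof.
move=> onA m0; pose f1 t := (t == 0) : nat; pose f2 t := (t < 2) : nat.
have one (s : {set gadget}) x y : #|s| <= 1 -> x \in s -> y \in s -> x = y.
  by move=> /card_le1_eqP h xs ys; apply: h.
have [/existsP[a as0]|none] :=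
    boolP [exists a, (inr a : gadget) \in play A gadget_source f1 0].
  exists f2; right; split; first exact: opt_cycle.
  have leg := onA gadget gadget_source f2; rewrite /alg_value.
  set s := play A gadget_source f2 in leg *.
  (* [f1] and [f2] both begin with [1], so the first moves are convertible. *)
  have as0' : (inr a : gadget) \in s 0 by [].
  have c0 : #|s 0| <= 1 by have [] := leg 0.
  have c1 : #|s 1| <= 1 by have [] := leg 1.
  have src t : gadget_source \notin s t.
    have [_ dis] := leg t; apply/negP=> h; have := disjointFr dis h.
    by rewrite in_setU source_burning.
  have sP t : protected s t \subset s 0 :|: s 1.
    apply/subsetP=> v /protectedP[[|[|j]] _ vj]; rewrite in_setU ?vj ?orbT //.
    have [h _] := leg j.+2; have
        : s j.+2 = set0 by apply/eqP; rewrite -cards_eq0 -leqn0.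
    by move=> e; rewrite e inE in vj.
  have n0 i : (inl i : gadget) \notin s 0.
    by apply/negP=> h; have := one _ _ _ c0 h as0'.
  apply: leq_trans (_ : #|star :|: s 1| <= _).
    apply: subset_leq_card; apply/subsetP=> -[i|b] /savedP vs; last first.
      by rewrite in_setU star_inr.
    rewrite in_setU star_inl /=; apply/negPn/negP=> is1.
    have [t it] : exists t, (inl i : gadget) \in burning gadget_source s t.
      apply: connect_burns sP _; apply: gadget_connected.
      - move=> i1 j1; rewrite !in_setU !(negbTE (n0 _)) /= => h h'.
        by have [] := one _ _ _ c1 h h'.
      - by rewrite in_setU negb_or !src.
      - by rewrite in_setU negb_or n0.
    by have := vs t; rewrite it.
  by apply: leq_trans (leq_card_setU _ _).1 _; rewrite card_star; lia.
exists f1; left; split; first exact: opt_star.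
have leg := onA gadget gadget_source f1; rewrite /alg_value.
set s := play A gadget_source f1 in leg none *.
have c0 : #|s 0| <= 1 by have [] := leg 0.
apply: (leq_trans _ c0); apply: subset_leq_card; apply/subsetP=> v /savedP vs.
have sP t : protected s t \subset s 0.
  apply/subsetP=> w /protectedP[[|j] _ vj] //.
  have [h _] := leg j.+1; have : s j.+1 = set0 by apply/eqP; rewrite -cards_eq0 -leqn0.
  by move=> e; rewrite e inE in vj.
have src : gadget_source \notin s 0.
  have [_ dis] := leg 0; apply/negP=> h; have := disjointFr dis h.
  by rewrite in_setU source_burning.
have nr a : (inr a : gadget) \notin s 0.
  by apply: contra none => h; apply/existsP; exists a.
apply/negPn/negP=> v0.
have [t vt] : exists t, v \in burning gadget_source s t;
    last by have := vs t; rewrite vt.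
apply: connect_burns sP _; case: v v0 {vs} => [i|b] v0.
  apply: gadget_connected => // i1 j1 h h'.
  by have [] := one _ _ _ c0 h h'.
have h0 : inside (~: s 0) gadget_source (inr ord0).
  by rewrite /inside !in_setC src nr.
apply: (connect_trans (connect1 h0)).
have [->//|b0] := eqVneq b ord0; apply: connect1.
by rewrite /inside !in_setC !nr /= (negbTE b0).
Qed.

End Gadget.

(* Competitive ratios over the reals *)
From mathcomp Require Import lra all_classical all_reals all_analysis.

Import Order.TTheory GRing.Theory Num.Theory.
Import numFieldNormedType.Exports.
Local Open Scope classical_set_scope.
Local Open Scope ring_scope.

(** In the first case of [pairing_bound], [3 tau <= sqrt n] and [37 tau <= 15 (3 tau)]. In the
    second, [sqrt n <= 3 ALG], so OPT is at most [n <= 3 ALG sqrt n]. *)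
Lemma pairing_competitive (R : realType) :
  competitive cactus pairing_rule (fun n : nat => 15 * Num.sqrt n%:R + 1 : R).
Proof.
move=> G r f cG; rewrite /alg_value (saved_ext r (play_pairing r f)).
set alg := #|saved r (strategy r f)|.
have s0 : 0 <= Num.sqrt #|G|%:R :> R by apply: sqrtr_ge0.
case: (pairing_bound r f cG) => [[tau tn ob]|na].
  apply: (@le_trans _ _ ((37 * tau + 1) * alg)%N%:R); first by rewrite ler_nat.
  rewrite natrM ler_wpM2r ?ler0n // natrD natrM lerD2r.
  have t3 : (3 * tau)%N%:R <= Num.sqrt #|G|%:R :> R.
    rewrite -[leLHS]ger0_norm ?ler0n // -sqrtr_sqr ler_wsqrtr //.
    by rewrite -natrX ler_nat expnMn.
  apply: (@le_trans _ _ (15 * (3 * tau)%N%:R)); last by rewrite ler_wpM2l ?ler0n.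
  by rewrite -!natrM ler_nat mulnA leq_mul2r orbT.
have on : (opt r f <= #|G|)%N by apply/opt_leP => s _; apply: max_card.
apply: (@le_trans _ _ #|G|%:R); first by rewrite ler_nat.
have sa : Num.sqrt #|G|%:R <= (3 * alg)%N%:R :> R.
  rewrite -[leRHS]ger0_norm ?ler0n // -sqrtr_sqr ler_wsqrtr //.
  by rewrite -natrX ler_nat expnMn.
rewrite -[leLHS]sqr_sqrtr ?ler0n // expr2.
apply: (@le_trans _ _ (Num.sqrt #|G|%:R * (3 * alg)%N%:R)).
  by rewrite ler_wpM2l.
rewrite natrM mulrA ler_wpM2r ?ler0n //.
rewrite mulrC (@le_trans _ _ (15 * Num.sqrt #|G|%:R)) ?lerDl ?ler01 //.
by rewrite ler_wpM2r // ler_nat.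
Qed.

Lemma not_little_o_competitive (R : realType) (A : decision_rule) (c : nat -> R) :
  online_algorithm A -> c =o_\oo (fun n : nat => Num.sqrt n%:R : R) ->
  ~ competitive cactus A c.
Proof.
move=> onA /eqoP co comp.
(* As [sqrt n <= 2 (k + 1)], factor [1/8] bounds the ratio by [(k + 1) / 4], below the forced ratios
   [k + 1] and [((k + 1)^2 + 1) / (k + 2)]. *)
have [N _ cN] := co (1 / 8) (ltac:(by rewrite divr_gt0)).
pose k := N.+1; pose n := (k.+1 ^ 2 + k + 4)%N.
have cn : `|c n| <= k.+1%:R / 4.
  have Nn : (N <= n)%N by rewrite /n /k; lia.
  have := cN n Nn; rewrite /= => h; apply: (le_trans h).
  rewrite ger0_norm ?sqrtr_ge0 //.
  have sn : Num.sqrt n%:R <= (2 * k.+1)%N%:R :> R.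
    rewrite -[leRHS]ger0_norm ?ler0n // -sqrtr_sqr ler_wsqrtr //.
    by rewrite -natrX ler_nat /n /k expnMn; nia.
  apply: (@le_trans _ _ (1 / 8 * (2 * k.+1)%N%:R));
      first by rewrite ler_wpM2l ?divr_ge0.
  by rewrite natrM; lra.
have m0 : (0 < k.+1 ^ 2)%N by rewrite expn_gt0.
have [f h] := @gadget_lower (k.+1 ^ 2) k A onA m0.
have := comp _ (gadget_source (k.+1 ^ 2) k) f (@gadget_cactus _ _).
rewrite card_gadget -/n => oc.
have k1 : 1 <= k%:R :> R by rewrite ler1n.
have kS : k.+1%:R = k%:R + 1 :> R by rewrite -natr1.
have bnd a b : (b <= opt (gadget_source (k.+1 ^ 2) k) f)%N ->
    (alg_value A (gadget_source (k.+1 ^ 2) k) f <= a)%N ->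
    b%:R <= k.+1%:R / 4 * a%:R :> R.
  move=> ob aa; apply: (@le_trans _ _ (opt (gadget_source (k.+1 ^ 2) k) f)%:R).
    by rewrite ler_nat.
  apply: (le_trans oc); apply: (@le_trans _ _ (`|c n| * a%:R)); last first.
    by rewrite ler_wpM2r ?ler0n.
  apply: (@le_trans _ _ (`|c n| * (alg_value A (gadget_source (k.+1 ^ 2) k) f)%:R)).
    by rewrite ler_wpM2r ?ler0n // ler_norm.
  by rewrite ler_wpM2l // ler_nat.
case: h => -[h1 h2]; have := bnd _ _ h1 h2.
  by rewrite mulr1 kS; lra.
rewrite -[(k.+1 ^ 2).+1%:R]natr1 natrX -[k.+2%:R]natr1 kS; nra.
Qed.

Theorem theorem3 (R : realType) :
  (exists A : decision_rule,
     online_algorithm A /\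
     competitive cactus A (fun n : nat => 15 * Num.sqrt n%:R + 1 : R)) /\
  (forall (A : decision_rule) (c : nat -> R),
     online_algorithm A ->
     c =o_\oo (fun n : nat => Num.sqrt n%:R : R) ->
     ~ competitive cactus A c).
Proof.
split; last exact: not_little_o_competitive.
by exists pairing_rule; split; [exact: pairing_online | exact: pairing_competitive].
Qed.
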